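(* Let $m\ge 2$ and $J\ge 2$ be integers, let $p_1,\dots,p_J$ be distinct primes, let $S=\langle p_1,\dots,p_J\rangle=\{\ell_k\}_{k\ge1}$ with $1=\ell_1<\ell_2<\cdots$ be the multiplicative semigroup they generate, and let $\Omega\subset\Sigma_m=\{0,\dots,m-1\}^{\mathbb N}$ be a nonempty closed set. (i) We have $$\dim_H(X_\Omega^{(S)})=\sup_\mu s(\Omega,\mu),$$ where the supremum is over all Borel probability measures $\mu$ on $\Omega$. (ii) We have $\dim_H(X_\Omega^{(S)})=\dim_M(X_\Omega^{(S)})$ if and only if the tree of prefixes of $\Omega$ is spherically symmetric, i.e. for every $k\in\mathbb N$, all prefixes $u\in\mathrm{Pref}_k(\Omega)$ have the same number of continuations in $\mathrm{Pref}_{k+1}(\Omega)$.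
   Context: Here $\mathbb N=\{1,2,\dots\}$ and $S=\{p_1^{a_1}\cdots p_J^{a_J}: a_1,\dots,a_J\in\mathbb Z_{\ge0}\}$, with elements listed in increasing order as $1=\ell_1<\ell_2<\cdots$. Write $(i,S)=1$ if no $p_j$ ($1\le j\le J$) divides $i$. For $x=(x_k)_{k\ge1}\in\Sigma_m$ put $x|_{iS}:=(x_{i\ell_k})_{k\ge1}\in\Sigma_m$, and $$X_\Omega^{(S)}:=\{x\in\Sigma_m:\ x|_{iS}\in\Omega\ \text{for all } i\in\mathbb N \text{ with } (i,S)=1\}.$$ $\gamma(S):=\sum_{k=1}^\infty \frac1{\ell_k}$. For $k\ge1$, $\mathrm{Pref}_k(\Omega)=\{u\in\{0,\dots,m-1\}^k:\Omega\cap[u]\ne\emptyset\}$, where $[u]$ is the cylinder of all sequences starting with $u$; a continuation of $u\in \mathrm{Pref}_k(\Omega)$ is a word $uj\in\mathrm{Pref}_{k+1}(\Omega)$ with $j\in\{0,\dots,m-1\}$. For a Borel probability measure $\mu$ on $\Omega$ and a finite partition $\alpha$, $H^\mu(\alpha)=-\sum_{B\in\alpha}\mu(B)\log_m\mu(B)$ is the Shannon entropy (base $m$, with $0\log_m 0=0$), and $H^\mu(\alpha|\beta)$ is the conditional entropy. Let $\alpha_k$ be the partition of $\Omega$ into cylinders of length $k$, i.e. into the sets $\Omega\cap[u]$, $u\in\mathrm{Pref}_k(\Omega)$. Define $$s(\Omega,\mu):=\gamma(S)^{-1}\sum_{k=1}^\infty H^\mu(\alpha_k)\Bigl(\frac1{\ell_k}-\frac1{\ell_{k+1}}\Bigr)=\gamma(S)^{-1}\Bigl(H^\mu(\alpha_1)+\sum_{k=1}^\infty\frac{H^\mu(\alpha_{k+1}|\alpha_k)}{\ell_{k+1}}\Bigr).$$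 $\Sigma_m$ carries the product topology; $\dim_H$ and $\dim_M$ denote Hausdorff and Minkowski (box) dimension with respect to the metric $\varrho(x,y)=m^{-\min\{n:\,x_n\ne y_n\}}$ on $\Sigma_m$ (with $\varrho(x,x)=0$). *)

(* Defs.v *)
From HB Require Import structures.
From mathcomp Require Import all_boot all_order all_algebra.
From mathcomp Require Import all_classical all_reals all_analysis.

Set Implicit Arguments.
Unset Strict Implicit.
Unset Printing Implicit Defensive.

Import Order.TTheory GRing.Theory Num.Theory.
Import numFieldNormedType.Exports.

Local Open Scope classical_set_scope.
Local Open Scope ring_scope.

(* The alphabet {0, ..., m-1}. The successor makes it nonempty for every m,
   as pointed (hence measurable) types require; it is 'I_m when 0 < m. *)
Definition letter (m : nat) : Type := 'I_m.-1.+1.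

HB.instance Definition _ (m : nat) := Finite.on (letter m).
HB.instance Definition _ (m : nat) := isPointed.Build (letter m) ord0.

(* Positions are counted from 1 in the mathematics and from 0 in the type nat:
   the n-th term x_n of x, for n >= 1, is [at1 x n] = x n.-1. *)
Definition Sigma (m : nat) : Type :=
  prod_topology (fun _ : nat => discrete_topology (letter m)).

HB.instance Definition _ (m : nat) :=
  Topological.copy (Sigma m)
    (prod_topology (fun _ : nat => discrete_topology (letter m))).
HB.instance Definition _ (m : nat) :=
  isPointed.Build (Sigma m) (fun _ : nat => (point : letter m)).

Definition at1 (m : nat) (x : Sigma m) (n : nat) : letter m := x n.-1.

Definition borel (m : nat) := g_sigma_algebraType (@open (Sigma m)).

Section Dimensions.
Context (R : realType) (m : nat).
Implicit Types (x y : Sigma m) (A : set (Sigma m)) (r s : R).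

Definition rho x y : R :=
  match pselect (exists n, x n != y n) with
  | left h => (m%:R ^+ (ex_minn h).+1)^-1
  | right _ => 0
  end.

(* rho is bounded, so this real supremum is the true one; sup set0 = 0. *)
Definition diam A : R := sup [set d | exists x y, [/\ A x, A y & d = rho x y]].

Definition hausdorff_premeasure s (delta : R) A : \bar R :=
  ereal_inf [set (\sum_(0 <= i <oo) (diam (U i) `^ s)%:E)%E | U in
    [set U : nat -> set (Sigma m) |
      A `<=` \bigcup_i U i /\ forall i, diam (U i) <= delta]].

Definition hausdorff_measure s A : \bar R :=
  ereal_sup [set hausdorff_premeasure s delta A | delta in
    [set delta : R | 0 < delta]].

(* Only s > 0 is used, so no convention for 0 to the power 0 is involved. *)
Definition dimH A : \bar R :=
  ereal_inf [set s%:E | s in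
    [set s : R | 0 < s /\ hausdorff_measure s A = 0%E]].

(* Least number of sets of diameter at most r that cover A. *)
Definition covering_number A r : R :=
  inf [set N%:R | N in
    [set N : nat | exists U : 'I_N -> set (Sigma m),
      A `<=` \bigcup_i U i /\ forall i, diam (U i) <= r]].

Definition minkowski_ratio A r : \bar R :=
  (ln (covering_number A r) / - ln r)%:E.

Definition has_dimM A : Prop := cvg (minkowski_ratio A r @[r --> 0^'+]).

Definition dimM A : \bar R := lim (minkowski_ratio A r @[r --> 0^'+]).

End Dimensions.

Section Semigroup.
Context (J : nat) (p : 'I_J -> nat).

Definition semigroup : set nat :=
  [set n | exists a : 'I_J -> nat, n = (\prod_(j < J) p j ^ a j)%N].

(* ell 1 < ell 2 < ... lists T; the value ell 0 plays no role. *)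
Definition increasing_enumeration (ell : nat -> nat) (T : set nat) : Prop :=
  (forall i j, (0 < i < j)%N -> (ell i < ell j)%N) /\
  [set ell k | k in [set k | (0 < k)%N]] = T.

Definition prime_to (i : nat) : Prop := forall j, ~~ (p j %| i)%N.

(* The sequence (x_{i ell_k})_{k >= 1}. *)
Definition restr_iS (m : nat) (ell : nat -> nat) (x : Sigma m) (i : nat) :
    Sigma m :=
  fun k => at1 x (i * ell k.+1)%N.

Definition X_set (m : nat) (ell : nat -> nat) (Omega : set (Sigma m)) :
    set (Sigma m) :=
  [set x | forall i, (0 < i)%N -> prime_to i -> Omega (restr_iS ell x i)].

End Semigroup.

Section Prefixes.
Context (m : nat) (Omega : set (Sigma m)).

Definition cylinder (k : nat) (u : k.-tuple (letter m)) : set (Sigma m) :=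
  [set x | forall i : 'I_k, x i = tnth u i].

Definition Pref (k : nat) : set (k.-tuple (letter m)) :=
  [set u | Omega `&` cylinder u !=set0].

Definition continuations (k : nat) (u : k.-tuple (letter m)) :
    {set letter m} :=
  [set j | `[< Pref [tuple of rcons u j] >]]%SET.

Definition spherically_symmetric : Prop :=
  forall k, (0 < k)%N -> forall u v : k.-tuple (letter m),
    Pref u -> Pref v -> #|continuations u| = #|continuations v|.

Definition cylinder_partition (k : nat) : set (set (Sigma m)) :=
  [set Omega `&` cylinder u | u in @Pref k].

End Prefixes.

Section Entropy.
Context (R : realType) (m : nat).

(* ln 0 = 0 in the library, which gives 0 log 0 = 0. *)
Definition entropy (mu : probability (borel m) R)
    (alpha : set (set (Sigma m))) : R :=
  - \sum_(B \in alpha) fine (mu B) * (ln (fine (mu B)) / ln m%:R).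

Definition gammaS (ell : nat -> nat) : R :=
  limn (fun n => \sum_(1 <= k < n) (ell k)%:R^-1 : R).

Definition s_value (ell : nat -> nat) (Omega : set (Sigma m))
    (mu : probability (borel m) R) : R :=
  (gammaS ell)^-1 *
  limn (fun n => \sum_(1 <= k < n)
    entropy mu (cylinder_partition Omega k)
    * ((ell k)%:R^-1 - (ell k.+1)%:R^-1) : R).

End Entropy.

(* Main.v *)
Require Import Defs.
From mathcomp Require Import all_boot all_order all_algebra.
From mathcomp Require Import all_classical all_reals all_analysis.
From mathcomp Require Import ring lra zify.

(** The semigroup S splits the positive integers into the fibres iS, one for
    each head i coprime to all p_j, and a point of X is an independent choice
    of a point of Omega on every fibre. Up to n, the fibre of i has k
    positions when n / ell_(k+1) < i <= n / ell_k. The heads have a density,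
    which is 1 / gamma(S) because the fibres exhaust the integers. Hence the
    average over the fibres up to n of a quantity a_k attached to fibres with
    k positions tends to gamma(S)^-1 times the sum of the
    a_k (1/ell_k - 1/ell_(k+1)) ([count_asym_wt], [fibre_average]). All three
    values in the theorem have this form: the entropies H(alpha_k) give
    s(Omega, mu), and the log_m |Pref_k(Omega)| give the box dimension,
    because the number of n-prefixes of X is the product over the fibres of
    numbers of prefixes of Omega.

    A measure is only used through its values on cylinders, which form a
    [consistent] family f of functions of the first k letters. Such a family
    on Omega induces on X the product family [fibre_mass f], and both bounds
    on the Hausdorff dimension compare [fibre_mass f] with m^(-sn).

    Lower bound. For f given by a measure mu on Omega and s < s(Omega, mu),
    the total mass of the n-cylinders with mass above m^(-sn) decays
    exponentially in n. This is a Chernoff bound: the sum of the (1+t)-th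
    powers of the masses factors over the fibres, and to first order in t its
    logarithm is -t times the sum of the fibre entropies ([chernoff]). The
    compactness of the sequence space turns a countable cover of X into a
    finite one, and the mass distribution principle follows
    ([hausdorff_neq0]).

    Upper bound. Among families prescribed on the first K levels, the maximum
    of s is found by backward recursion, as a logarithmic partition function
    [tau]. The optimal family [opt_mass] has the property that for every
    single point x of X, and not only almost surely, the quantities
    (ln of the mass of x|n) + s n ln m, divided by n and summed with the
    weights 1/(n+1), stay bounded below: the sum telescopes along each fibre
    ([log_cond_avg], [Phi_avg]). Here s is that maximum, up to the
    contribution of the levels beyond K. As the harmonic series diverges, the
    mass is at least m^(-(s+e)n) for infinitely many n. The cylinders of that
    size cover X, and there are at most m^((s+e)n) of them on level n
    ([hausdorff_eq0]). A finite combination of Dirac masses realizes the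
    optimal family on the first K levels, and the levels beyond K contribute
    at most the tail of the series of the 1/ell_k, so letting K grow gives
    dim_H X <= sup s.

    Equality with the box dimension. Always H(alpha_k) <= log |Pref_k|. If
    the tree is spherically symmetric, then the uniform weights are
    consistent and attain equality on every level. If it branches unevenly
    at level k, then mu cannot be uniform on levels k and k+1 at once: with
    c_u the number of continuations of u, Gibbs' inequality gives
    H(alpha_k) + H(alpha_(k+1)) <= 2 log of the sum of the sqrt(c_u), which
    is strictly below log |Pref_k| + log |Pref_(k+1)| by the Cauchy-Schwarz
    inequality. The gap does not depend on mu, hence the supremum stays
    below the box dimension. *)

Set Implicit Arguments.
Unset Strict Implicit.
Unset Printing Implicit Defensive.

Import Order.TTheory GRing.Theory Num.Theory.
Import numFieldNormedType.Exports.

Local Open Scope classical_set_scope.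
Local Open Scope ring_scope.

(** * Words as truncated sequences, and consistent families of weights *)

Section Words.
Context (m : nat).
Implicit Types (x y z : Sigma m) (n k : nat) (a : letter m).

Definition upd x n a : Sigma m := fun k => if k == n then a else x k.

Definition agree n x y : Prop := forall k, (k < n)%N -> x k = y k.

(** Padding turns words into sequences, so that functions of the first n letters
    can be handled as functions of sequences that are [local]; the padding
    letter never matters for them. *)
Definition ext n (u : n.-tuple (letter m)) : Sigma m :=
  fun k => nth (ord0 : letter m) u k.

Definition trunc n x : n.-tuple (letter m) := [tuple (x i : letter m) | i < n].

Definition local (T : Type) n (g : Sigma m -> T) : Prop :=
  forall x y, agree n x y -> g x = g y.

Lemma agree_sym n x y : agree n x y -> agree n y x.
Proof. by move=> h k kn; rewrite h. Qed.

Lemma agree_trans n x y z : agree n x y -> agree n y z -> agree n x z.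
Proof. by move=> h h' k kn; rewrite h // h'. Qed.

Lemma agree_le n k x y : (k <= n)%N -> agree n x y -> agree k x y.
Proof. by move=> kn h j jk; apply: h; exact: leq_trans kn. Qed.

Lemma agree_upd n x a : agree n (upd x n a) x.
Proof. by move=> k kn; rewrite /upd (ltn_eqF kn). Qed.

Lemma updE x n a : upd x n a n = a. Proof. by rewrite /upd eqxx. Qed.

Lemma agreeS n x y : agree n.+1 x y <-> agree n x y /\ x n = y n.
Proof.
split=> [h|[h e] k]; first by split; [apply: agree_le h | apply: h].
by rewrite ltnS leq_eqVlt => /orP[/eqP->//|]; apply: h.
Qed.

Lemma agree_updS n x y a : agree n x y -> agree n.+1 (upd x n a) (upd y n a).
Proof. by move=> h k kn; rewrite /upd; case: eqP => // /eqP kn'; apply: h; lia. Qed.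

Lemma agreeS_upd n x y : agree n x y -> agree n.+1 x (upd y n (x n)).
Proof. by move=> h; apply/agreeS; split; [move=> k kn; rewrite h// agree_upd|rewrite updE].
  Qed.

Lemma ext_trunc n x : agree n (ext (trunc n x)) x.
Proof.
by move=> k kn; rewrite /ext -[k]/(val (Ordinal kn)) -tnth_nth tnth_mktuple.
Qed.

Lemma trunc_ext n (u : n.-tuple (letter m)) : trunc n (ext u) = u.
Proof. by apply: eq_from_tnth => i; rewrite tnth_mktuple /ext (tnth_nth ord0). Qed.

Lemma trunc_agree n x y : agree n x y <-> trunc n x = trunc n y.
Proof.
split=> [h|h k kn]; first by apply: eq_from_tnth => i; rewrite !tnth_mktuple h.
by have := congr1 (fun u => tnth u (Ordinal kn)) h; rewrite !tnth_mktuple.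
Qed.

Lemma cylinderP n (u : n.-tuple (letter m)) x : cylinder u x <-> agree n x (ext u).
Proof.
rewrite /cylinder /= /agree /ext; split=> [h k kn|h i].
  by rewrite (h (Ordinal kn)) (tnth_nth ord0).
by rewrite h // (tnth_nth ord0).
Qed.

Lemma ext_rcons n (u : n.-tuple (letter m)) a :
  ext [tuple of rcons u a] = upd (ext u) n a.
Proof.
apply/funext => k; rewrite /ext /upd /= nth_rcons size_tuple.
case: ltngtP => // kn; by rewrite nth_default // size_tuple ltnW.
Qed.

Section Wsum.
Context (R : realType).
Implicit Types (g h : Sigma m -> R).

Definition wsum n g : R := \sum_(u : n.-tuple (letter m)) g (ext u).

Lemma wsum0 g : wsum 0 g = g (fun=> ord0).
Proof.
rewrite /wsum (bigD1 [tuple]) //= big1 ?addr0; last first.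
  by move=> u /eqP; case; exact: tuple0.
by congr g; apply/funext => k; rewrite /ext nth_nil.
Qed.

(** A word of length n+1 is a word of length n and a letter: this makes induction
    on the length possible without handling words. *)
Lemma wsumS n g : wsum n.+1 g = wsum n (fun x => \sum_(a : letter m) g (upd x n a)).
Proof.
rewrite /wsum pair_big_dep /=.
rewrite (reindex (fun ua : n.-tuple (letter m) * letter m => [tuple of rcons ua.1 ua.2])) /=.
  by apply: eq_bigr => -[u a] _; rewrite ext_rcons.
exists (fun w : n.+1.-tuple (letter m) => (trunc n (ext w), ext w n)).
  move=> [u a] _ /=; rewrite ext_rcons updE -[in RHS](trunc_ext u).
  by congr pair; apply/trunc_agree/agree_upd.
move=> w _ /=; rewrite -[LHS]trunc_ext -[RHS]trunc_ext; apply/trunc_agree.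
rewrite ext_rcons; apply/agree_sym/agreeS_upd/agree_sym; exact: ext_trunc.
Qed.

Lemma eq_wsum n g h : g =1 h -> wsum n g = wsum n h.
Proof. by move=> e; apply: eq_bigr => u _; rewrite e. Qed.

Lemma wsum_le n g h : (forall x, g x <= h x) -> wsum n g <= wsum n h.
Proof. by move=> e; apply: ler_sum. Qed.

Lemma wsum_ge0 n g : (forall x, 0 <= g x) -> 0 <= wsum n g.
Proof. by move=> e; apply: sumr_ge0. Qed.

Lemma wsumZ n c g : wsum n (fun x => c * g x) = c * wsum n g.
Proof. by rewrite /wsum mulr_sumr. Qed.

Lemma wsumZr n c g : wsum n (fun x => g x * c) = wsum n g * c.
Proof. by rewrite /wsum mulr_suml. Qed.

Lemma wsumD n g h : wsum n (fun x => g x + h x) = wsum n g + wsum n h.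
Proof. by rewrite /wsum big_split. Qed.

Lemma wsumN n g : wsum n (fun x => - g x) = - wsum n g.
Proof. by rewrite /wsum sumrN. Qed.

Lemma wsum_sum n (I : Type) (r : seq I) (P : pred I) (F : I -> Sigma m -> R) :
  wsum n (fun x => \sum_(i <- r | P i) F i x) = \sum_(i <- r | P i) wsum n (F i).
Proof. by rewrite /wsum exchange_big. Qed.

(** The values on cylinders of a probability measure on sequences: f k x is the
    mass of the k-cylinder around x. *)
Definition consistent (f : nat -> Sigma m -> R) : Prop :=
  [/\ forall k, local k (f k), forall k x, 0 <= f k x, forall x, f 0 x = 1 &
      forall k x, \sum_(a : letter m) f k.+1 (upd x k a) = f k x].

(** Summing out the letters beyond k does not change the mass, by consistency. *)
Lemma consistent_wsum f k K h : consistent f -> local k h -> (k <= K)%N ->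
  wsum K (fun x => f K x * h x) = wsum k (fun x => f k x * h x).
Proof.
move=> [loc _ _ con] lh; elim: K => [|K IH]; first by rewrite leqn0 => /eqP ->.
rewrite leq_eqVlt => /orP[/eqP <-//|]; rewrite ltnS => kK.
rewrite wsumS -IH //; apply: eq_wsum => x; rewrite -con mulr_suml.
apply: eq_bigr => a _; congr (_ * _); apply: lh.
exact: agree_le (agree_upd _ _).
Qed.

Lemma consistent_wsum1 f n : consistent f -> wsum n (f n) = 1.
Proof.
move=> cf; rewrite (@eq_wsum _ _ (fun x => f n x * 1)); last by move=> x; rewrite mulr1.
rewrite (consistent_wsum cf (k := 0)) // wsum0 mulr1; by case: cf => _ _ ->.
Qed.

Lemma consistent_le f k n x : consistent f -> (k <= n)%N -> f n x <= f k x.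
Proof.
move=> [loc f0 _ con]; elim: n => [|n IH]; first by rewrite leqn0 => /eqP ->.
rewrite leq_eqVlt => /orP[/eqP <-//|]; rewrite ltnS => kn.
apply: le_trans (IH kn); rewrite -[leRHS]con (bigD1 (x n)) //=.
rewrite (loc n.+1 x (upd x n (x n))) ?lerDl ?sumr_ge0 //.
by apply: agreeS_upd.
Qed.

Lemma consistent_le1 f n x : consistent f -> f n x <= 1.
Proof. by move=> cf; case: (cf) => _ _ /(_ x) <- _; apply: consistent_le. Qed.

Lemma wsum_indic n x : wsum n (fun y => (`[< agree n y x >])%:R) = 1.
Proof.
rewrite /wsum (bigD1 (trunc n x)) //= big1 ?addr0.
  by rewrite asboolT //; exact: ext_trunc.
move=> u uneq; rewrite asboolF // => /trunc_agree; rewrite trunc_ext => e.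
by rewrite e eqxx in uneq.
Qed.

End Wsum.
End Words.

(** * The partition of the positive integers into the fibres iS *)

Definition generated (J : nat) (p : 'I_J -> nat) (ell : nat -> nat) : Prop :=
  [/\ (0 < J)%N, forall j, prime (p j) &
      increasing_enumeration ell (semigroup p)].

Section Arithmetic.
Context (J : nat) (p : 'I_J -> nat) (ell : nat -> nat).
Context (G : generated p ell).
Local Notation L k := (ell k.+1).

Lemma generated_gt0 : (0 < J)%N. Proof. by case: G. Qed.

Lemma generated_prime j : prime (p j). Proof. by case: G. Qed.

Lemma generated_enum : increasing_enumeration ell (semigroup p). Proof. by case: G. Qed.

(** Boolean form of [prime_to], usable as a summation condition. *)
Definition cop (i : nat) : bool := [forall j, ~~ (p j %| i)%N].

Lemma copP i : cop i <-> prime_to p i.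
Proof. by split=> [/forallP|h]; [|apply/forallP]. Qed.

Lemma cop_gt0 i : cop i -> (0 < i)%N.
Proof. by case: i => // /forallP /(_ (Ordinal generated_gt0)); rewrite dvdn0. Qed.

Lemma ell_incr i j : (i < j)%N -> (L i < L j)%N.
Proof. by case: generated_enum => h _ ij; apply: h; rewrite /= ltnS. Qed.

Lemma ell_leE i j : (L i <= L j)%N = (i <= j)%N.
Proof.
case: (leqP i j) => [|ji]; last by rewrite leqNgt ell_incr.
by rewrite leq_eqVlt => /orP[/eqP->|/ell_incr/ltnW->//]; rewrite leqnn.
Qed.

Lemma ell_inj i j : L i = L j -> i = j.
Proof. by move=> e; apply/eqP; rewrite eqn_leq -ell_leE -(ell_leE j i) e leqnn. Qed.

Lemma ell_semigroup k : semigroup p (L k).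
Proof. by case: generated_enum => _ <-; exists k.+1. Qed.

Lemma semigroup_ell s : semigroup p s -> exists k, s = L k.
Proof. by case: generated_enum => _ <- [[|k]] //= _ <-; exists k. Qed.

Lemma semigroup_gt0 s : semigroup p s -> (0 < s)%N.
Proof.
by move=> [a ->]; apply: prodn_gt0 => j; rewrite expn_gt0 prime_gt0 // generated_prime.
Qed.

Lemma ell_gtk k : (k < L k)%N.
Proof.
elim: k => [|k IH]; first exact: semigroup_gt0 (ell_semigroup 0).
exact: leq_ltn_trans IH (ell_incr (ltnSn _)).
Qed.

Lemma ell_gt0 k : (0 < L k)%N.
Proof. exact: leq_ltn_trans (ell_gtk k). Qed.

Lemma ell1 : L 0 = 1%N.
Proof.
have [|k ek] := @semigroup_ell 1%N.
  by exists (fun=> 0%N); rewrite big1.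
have := ell_gtk k; rewrite -ek ltnS leqn0 => /eqP k0; by rewrite k0 in ek.
Qed.

Lemma coprime_semigroup s i : semigroup p s -> cop i -> coprime s i.
Proof.
move=> [a ->] /forallP ci.
apply: (big_ind (fun n => coprime n i)) => [|x y hx hy|j _].
- exact: coprime1n.
- by rewrite coprimeMl hx.
- by apply: coprimeXl; rewrite prime_coprime ?ci //; exact: generated_prime.
Qed.

(** L k and L k' are products of the p_j, hence coprime to the heads, so each
    of them divides the other. *)
Lemma decomp_inj i i' k k' : cop i -> cop i' -> (i * L k = i' * L k')%N ->
  i = i' /\ k = k'.
Proof.
move=> ci ci' e.
have d1 : (L k %| L k')%N.
  rewrite -(Gauss_dvdr _ (coprime_semigroup (ell_semigroup k) ci')) -e.
  exact: dvdn_mull.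
have d2 : (L k' %| L k)%N.
  rewrite -(Gauss_dvdr _ (coprime_semigroup (ell_semigroup k') ci)) e.
  exact: dvdn_mull.
have eL : L k = L k' by apply/eqP; rewrite eqn_dvd d1.
split; last exact: ell_inj.
by move/eqP: e; rewrite eL eqn_pmul2r ?ell_gt0 // => /eqP.
Qed.

Lemma decomp_ex n : (0 < n)%N -> exists i k, cop i /\ n = (i * L k)%N.
Proof.
suff : (0 < n)%N -> exists i s, [/\ cop i, semigroup p s & n = (i * s)%N].
  move=> h /h[i [s [ci /semigroup_ell[k ->] ->]]]; by exists i, k.
have [N] := ubnP n; elim: N n => // N IH n nN n0.
case: (boolP (cop n)) => [cn|].
  exists n, 1%N; split => //; last by rewrite muln1.
  by exists (fun=> 0%N); rewrite big1.
rewrite negb_forall => /existsP[j]; rewrite negbK => /dvdnP[q nq].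
have pj := prime_gt1 (generated_prime j).
have [||i [s [ci [a sa] e]]] := IH q; [nia|nia|].
exists i, (s * p j)%N; split => //; last by rewrite mulnA -e.
exists (fun l => a l + (l == j))%N.
rewrite sa [RHS](eq_bigr (fun l => p l ^ a l * p l ^ (l == j))%N); last first.
  by move=> l _; rewrite expnD.
rewrite big_split /=; congr muln.
rewrite (bigD1 j) //= eqxx expn1 big1 ?muln1 // => l /negPf ->; by rewrite expn0.
Qed.

(** The number of positions of the fibre of i that are at most n. The search can
    stop at n because ell_(k+1) > k. *)
Definition fibre_len n i : nat := find (fun k => (n < i * L k)%N) (iota 0 n.+1).

(** This adjunction characterizes the length; all other facts about it follow. *)
Lemma ltn_fibre_len n i k : (0 < i)%N -> (k < fibre_len n i)%N = (i * L k <= n)%N.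
Proof.
move=> i0.
have hasn : has (fun k => (n < i * L k)%N) (iota 0 n.+1).
  apply/hasP; exists n; first by rewrite mem_iota; lia.
  have := ell_gtk n; nia.
have kn : (fibre_len n i < n.+1)%N by rewrite -[X in (_ < X)%N](size_iota 0) -has_find.
apply/idP/idP => h.
  have := before_find 0%N h; rewrite nth_iota; last by lia.
  by rewrite add0n ltnNge => /negbFE.
rewrite ltnNge; apply/negP => h2.
have := nth_find 0%N hasn; rewrite -/(fibre_len n i) nth_iota // add0n.
have : (L (fibre_len n i) <= L k)%N by rewrite ell_leE.
nia.
Qed.

Lemma fibre_len_le n i K : (0 < i)%N -> (n < i * L K)%N -> (fibre_len n i <= K)%N.
Proof. by move=> i0 h; rewrite leqNgt ltn_fibre_len // -ltnNge. Qed.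

Lemma fibre_len0 n i : (0 < i)%N -> (n < i)%N -> fibre_len n i = 0%N.
Proof.
by move=> i0 ni; apply/eqP; rewrite -leqn0; apply: fibre_len_le; rewrite ?ell1 ?muln1.
Qed.

(** Passing from n to n+1 adds one letter to exactly one fibre, which makes
    induction on n possible in all product formulas. *)
Lemma fibre_lenS n i0 k0 i : cop i0 -> n.+1 = (i0 * L k0)%N -> cop i ->
  fibre_len n.+1 i = (fibre_len n i + (i == i0))%N.
Proof.
move=> ci0 e ci; have ig0 := cop_gt0 ci; have i0g0 := cop_gt0 ci0.
case: eqP => [ii0|/eqP ii0].
  subst i; have h k : (k < fibre_len n i0)%N = (k < k0)%N.
    rewrite ltn_fibre_len // [RHS]ltnNge -(ell_leE k0 k) -ltnNge;
      rewrite -[in RHS](ltn_pmul2l i0g0) -e; lia.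
  have h' k : (k < fibre_len n.+1 i0)%N = (k <= k0)%N.
    by rewrite ltn_fibre_len // e leq_pmul2l // ell_leE.
  have := h' k0; have := h' k0.+1; have := h k0; have := h k0.-1; lia.
rewrite addn0; have h k : (k < fibre_len n.+1 i)%N = (k < fibre_len n i)%N.
  rewrite !ltn_fibre_len // leq_eqVlt ltnS; case: eqP => // e'.
  have [] := @decomp_inj i i0 k k0 ci ci0; first by rewrite -e.
  by move/eqP: ii0.
have := h (fibre_len n i); have := h (fibre_len n.+1 i); lia.
Qed.

Lemma fibre_len_at n i0 k0 : cop i0 -> n.+1 = (i0 * L k0)%N -> fibre_len n i0 = k0.
Proof.
move=> ci0 e; have i0g0 := cop_gt0 ci0.
have h k : (k < fibre_len n i0)%N = (k < k0)%N.
  rewrite ltn_fibre_len // [RHS]ltnNge -(ell_leE k0 k) -ltnNge;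
    rewrite -[in RHS](ltn_pmul2l i0g0) -e; lia.
have := h k0; have := h k0.-1; have := h (fibre_len n i0); lia.
Qed.

Section Restr.
Context (m : nat).
Implicit Types (x y : Sigma m).
Local Notation res := (restr_iS ell).

Lemma restr_upd n i0 k0 i x a : cop i0 -> n.+1 = (i0 * L k0)%N -> cop i ->
  res (upd x n a) i = if i == i0 then upd (res x i) k0 a else res x i.
Proof.
move=> ci0 e ci; apply/funext => k.
have ig := cop_gt0 ci; have Lk := ell_gt0 k.
rewrite /restr_iS /at1 /upd.
have -> : ((i * L k).-1 == n) = (i * L k == i0 * L k0)%N by rewrite -e; nia.
case: eqP => [/(decomp_inj ci ci0)[-> ->]|ne]; first by rewrite !eqxx.
case: eqP => // ii0; case: eqP => // kk1; by rewrite ii0 kk1 in ne.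
Qed.

Lemma restr_agree n i x y : (0 < i)%N -> agree n x y ->
  agree (fibre_len n i) (res x i) (res y i).
Proof.
move=> i0 h k; rewrite ltn_fibre_len // => kn; rewrite /restr_iS /at1; apply: h.
have := ell_gt0 k; nia.
Qed.

Section Product.
Context (R : realType).

(** Independence of the fibres: by induction on n, where summing over the letter
    at position n+1 only affects the factor of the fibre through n+1. *)
Lemma wsum_prod M n (F : nat -> Sigma m -> R) : (n < M)%N ->
  (forall i, cop i -> local (fibre_len n i) (F i)) ->
  wsum n (fun x => \prod_(i < M | cop i) F i (res x i)) =
  \prod_(i < M | cop i) wsum (fibre_len n i) (F i).
Proof.
elim: n F => [|n IH] F nM lF.
  rewrite wsum0; apply: eq_bigr => i ci.
  rewrite (_ : fibre_len 0 i = 0%N) ?wsum0 //.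
  by rewrite fibre_len0 ?cop_gt0.
have [i0 [k0 [ci0 e]]] := decomp_ex (ltn0Sn n).
have i0M : (i0 < M)%N by have := ell_gt0 k0; nia.
set F' := fun i => if i == i0 then (fun y => \sum_(a : letter m) F i (upd y k0 a)) else F i.
rewrite wsumS (@eq_wsum _ _ _ _ (fun x => \prod_(i < M | cop i) F' i (res x i))); last first.
  move=> x; rewrite (bigD1 (Ordinal i0M)) //= {1}/F' eqxx mulr_suml.
  apply: eq_bigr => a _; rewrite (bigD1 (Ordinal i0M)) //=.
  rewrite (restr_upd _ _ ci0 e) // eqxx; congr (_ * _).
  apply: eq_bigr => i /andP[ci]; rewrite -val_eqE /= => /negPf ii0.
  by rewrite (restr_upd _ _ ci0 e) // /F' ii0.
rewrite IH; [|lia|]; last first.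
  move=> i ci x y xy; rewrite /F'; have := lF i ci; rewrite (fibre_lenS ci0 e ci).
  case: eqP => [ii0 lo|_]; last by rewrite addn0; apply.
  subst i; rewrite addn1 in lo; apply: eq_bigr => a _; apply: lo.
  by move: xy; rewrite (fibre_len_at ci0 e); apply: agree_updS.
apply: eq_bigr => i ci; rewrite (fibre_lenS ci0 e ci) /F'; case: eqP => [ii0|_];
  last by rewrite addn0.
by subst; rewrite addn1 wsumS (fibre_len_at ci0 e).
Qed.

(** The cylinder masses of the product measure on X when every fibre carries f. *)
Definition fibre_mass (f : nat -> Sigma m -> R) n x : R :=
  \prod_(i < n.+1 | cop i) f (fibre_len n i) (res x i).

(** The heads beyond n have an empty fibre up to n, and f 0 = 1. *)
Lemma fibre_mass_widen f n M x : consistent f -> (n < M)%N ->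
  fibre_mass f n x = \prod_(i < M | cop i) f (fibre_len n i) (res x i).
Proof.
move=> [_ _ f0 _] nM; rewrite /fibre_mass.
rewrite -(big_mkord cop (fun i => f (fibre_len n i) (res x i))).
rewrite -(big_mkord cop (fun i => f (fibre_len n i) (res x i))).
rewrite (big_cat_nat _ nM) //= [X in _ * X]big_nat_cond [X in _ * X]big1 ?mulr1 //.
move=> i /andP[/andP[ni _] ci]; rewrite fibre_len0 ?f0 //; exact: cop_gt0.
Qed.

Lemma fibre_mass_consistent f : consistent f -> consistent (fibre_mass f).
Proof.
move=> cf; have [lf f0 f1 con] := cf; split.
- move=> n x y xy; apply: eq_bigr => i ci; apply: lf; apply: restr_agree => //.
  exact: cop_gt0.
- by move=> n x; apply: prodr_ge0.
- move=> x; rewrite /fibre_mass big1 // => i ci.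
  by rewrite fibre_len0 ?f1 //; exact: cop_gt0.
move=> n x.
have [i0 [k0 [ci0 e]]] := decomp_ex (ltn0Sn n).
have i0M : (i0 < n.+2)%N by have := ell_gt0 k0; nia.
rewrite (@fibre_mass_widen _ n n.+2) // (bigD1 (Ordinal i0M)) //=.
rewrite (fibre_len_at ci0 e) -con mulr_suml; apply: eq_bigr => a _.
rewrite /fibre_mass (bigD1 (Ordinal i0M)) //=.
rewrite (restr_upd _ _ ci0 e) // eqxx (fibre_lenS ci0 e)
  // eqxx addn1 (fibre_len_at ci0 e); congr (_ * _).
apply: eq_bigr => i /andP[ci]; rewrite -val_eqE /= => /negPf ii0.
by rewrite (restr_upd _ _ ci0 e) // (fibre_lenS ci0 e) // ii0 addn0.
Qed.

End Product.
End Restr.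
End Arithmetic.

(** * The density of the heads and the value of gamma(S) *)

Lemma linear_bound_le0 (R : realType) (a B : R) :
  (forall n : nat, n%:R * a <= B) -> a <= 0.
Proof.
move=> h; rewrite leNgt; apply/negP => a0.
have := h (Num.bound (B / a)); apply/negP; rewrite -ltNge -ltr_pdivrMr //.
have [B0|B0] := leP 0 B; first by apply: archi_boundP; rewrite divr_ge0 // ltW.
by apply: lt_le_trans (ler0n _ _); rewrite ltr_pdivrMr // mul0r.
Qed.

Section Density.
Context (J : nat) (p : 'I_J -> nat) (ell : nat -> nat).
Context (G : generated p ell).
Local Notation L k := (ell k.+1).
Local Notation cop := (cop p).
Local Notation fibre_len := (fibre_len ell).
Context (R : realType).

Definition cop_count n : nat := (\sum_(i < n.+1 | cop i) 1)%N.

Lemma cop_countS n : cop_count n.+1 = (cop_count n + cop n.+1)%N.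
Proof.
rewrite /cop_count -(big_mkord cop (fun=> 1%N)) -(big_mkord cop (fun=> 1%N)).
by rewrite [LHS]big_mkcond big_nat_recr //= -big_mkcond /=; case: cop.
Qed.

Lemma cop_count0 : cop_count 0 = 0%N.
Proof.
rewrite /cop_count -(big_mkord cop (fun=> 1%N)) big_mkcond big_nat1.
by case: ifP => // /(cop_gt0 G).
Qed.

Lemma cop_count_leq n : (cop_count n <= n)%N.
Proof. by elim: n => [|n IH]; rewrite ?cop_count0 // cop_countS; case: cop; lia. Qed.

Definition modulus : nat := (\prod_(j < J) p j)%N.

Lemma modulus_gt0 : (0 < modulus)%N.
Proof. by apply: prodn_gt0 => j; apply: prime_gt0; exact: (generated_prime G). Qed.

Lemma cop_period i : cop (i + modulus) = cop i.
Proof.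
by apply: eq_forallb => j; rewrite dvdn_addl // /modulus (bigD1 j) //= dvdn_mulr.
Qed.

(** Being coprime to all p_j is periodic with period the product of the p_j. *)
Definition cop_density : R := (cop_count modulus)%:R / modulus%:R.

Lemma cop1 : cop 1.
Proof.
by apply/forallP => j; rewrite dvdn1; have := prime_gt1 (generated_prime G j);
  case: eqP => // ->.
Qed.

Lemma cop_count_ge1 n : (0 < n)%N -> (0 < cop_count n)%N.
Proof.
case: n => // n _; elim: n => [|n IH]; first by rewrite cop_countS cop_count0 cop1.
by rewrite cop_countS ltn_addr.
Qed.

Lemma cop_density_gt0 : 0 < cop_density.
Proof. by rewrite divr_gt0 // ltr0n ?cop_count_ge1 ?modulus_gt0. Qed.

Lemma cop_count_period n : cop_count (n + modulus) = (cop_count n + cop_count modulus)%N.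
Proof.
elim: n => [|n IH]; first by rewrite cop_count0.
by rewrite addSn !cop_countS IH -addSn cop_period; lia.
Qed.

Lemma cop_density_le1 : cop_density <= 1.
Proof. by rewrite ler_pdivrMr ?ltr0n ?modulus_gt0 // mul1r ler_nat cop_count_leq. Qed.

Lemma cop_count_density n : `|(cop_count n)%:R - n%:R * cop_density| <= modulus%:R.
Proof.
have [N] := ubnP n; elim: N n => // N IH n nN.
case: (ltnP n modulus) => nm; last first.
  have lt : (n - modulus < N)%N by have := modulus_gt0; lia.
  have := IH _ lt.
  rewrite -[in X in _ -> X](subnK nm) cop_count_period !natrD mulrDl.
  rewrite [X in _ - (_ + X)](_ : _ = (cop_count modulus)%:R); last first.
    by rewrite /cop_density mulrCA divff ?mulr1 // pnatr_eq0; have := modulus_gt0; lia.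
  by rewrite opprD addrACA subrr addr0.
have := cop_count_leq n; rewrite -(ler_nat R) => h1.
have h2 : (n%:R : R) <= modulus%:R by rewrite ler_nat ltnW.
have h3 : n%:R * cop_density <= n%:R by rewrite ler_piMr // cop_density_le1.
have h4 : 0 <= n%:R * cop_density by rewrite mulr_ge0 // ltW // cop_density_gt0.
have h5 : 0 <= ((cop_count n)%:R : R) by [].
rewrite ler_norml; apply/andP; split; lra.
Qed.

Lemma cop_count_div n l : (0 < l)%N ->
  `|(cop_count (n %/ l))%:R - n%:R * cop_density / l%:R| <= modulus%:R + 1.
Proof.
move=> l0; have := cop_count_density (n %/ l); set q := (n %/ l)%N => h.
have l0R : 0 < (l%:R : R) by rewrite ltr0n.
have hq : `|q%:R - n%:R / l%:R :> R| <= 1.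
  have e : n%:R = q%:R * l%:R + (n %% l)%:R :> R.
    by rewrite -natrM -natrD -divn_eq.
  rewrite e mulrDl mulfK ?gt_eqF // opprD addrA subrr sub0r normrN ger0_norm.
    by rewrite ler_pdivrMr // mul1r ler_nat ltnW // ltn_pmod.
  by rewrite divr_ge0 // ltW.
have hq' : `|q%:R * cop_density - n%:R * cop_density / l%:R| <= 1.
  rewrite (_ : _ - _ = (q%:R - n%:R / l%:R) * cop_density); last by ring.
  rewrite normrM; apply: mulr_ile1 => //.
  by rewrite ger0_norm ?cop_density_le1 // ltW // cop_density_gt0.
have := ler_normD ((cop_count q)%:R - q%:R * cop_density)
  (q%:R * cop_density - n%:R * cop_density / l%:R).
by rewrite addrA subrK => /le_trans; apply; apply: lerD.
Qed.

(** Summation by increments: a position k contributes to the fibre of i when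
    i <= n / L k, so the sum over heads reduces to counting heads. *)
Lemma cop_count_swap n K (b : nat -> R) :
  \sum_(i < n.+1 | cop i) \sum_(k < minn (fibre_len n i) K) b k =
  \sum_(k < K) b k * (cop_count (n %/ L k))%:R.
Proof.
under eq_bigr => i ci.
  rewrite -(big_mkord xpredT b) (big_nat_widen _ _ _ _ _ (geq_minr _ _)) /=.
  rewrite big_mkord.
  rewrite (eq_bigl (fun k : 'I_K => (i * L k <= n)%N)); last first.
    by move=> k /=; rewrite ltn_min ltn_ord andbT (ltn_fibre_len G) // (cop_gt0 G).
  over.
rewrite (exchange_big_dep xpredT) //=; apply: eq_bigr => k _.
have Lk := ell_gt0 G k.
rewrite sumr_const mulr_natr; congr (_ *+ _).
rewrite /cop_count -(big_mkord cop (fun=> 1%N)) (big_nat_widen _ _ n.+1).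
  rewrite big_mkord -sum1_card; apply: eq_bigl => i.
  by rewrite unfold_in /= ltnS leq_divRL.
by rewrite ltnS leq_div.
Qed.

(** The fibres partition the integers from 1 to n. *)
Lemma sum_fibre_len n M : (n < M)%N -> (\sum_(i < M | cop i) fibre_len n i)%N = n.
Proof.
elim: n => [|n IH] nM.
  by rewrite big1 // => i ci; rewrite (fibre_len0 G) //; exact: (cop_gt0 G).
have [i0 [k0 [ci0 e]]] := decomp_ex G (ltn0Sn n).
have i0M : (i0 < M)%N by have := ell_gt0 G k0; nia.
rewrite (eq_bigr (fun i : 'I_M => fibre_len n i + (i == Ordinal i0M))%N); last first.
  by move=> i ci; rewrite (fibre_lenS G ci0 e).
rewrite big_split /= IH; last by lia.
rewrite (bigD1 (Ordinal i0M)) //= eqxx big1 ?addn0 ?addn1 //.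
by move=> i /andP[_ /negPf ->].
Qed.

Definition inv_sum K : R := \sum_(k < K) (L k)%:R^-1.

(** The error stays bounded in n, since each of the K counts of heads is
    within a constant of its linear approximation. *)
Lemma count_asym (b : nat -> R) K : exists B, 0 <= B /\ forall n,
  `| \sum_(i < n.+1 | cop i) \sum_(k < minn (fibre_len n i) K) b k
    - n%:R * (cop_density * \sum_(k < K) b k / (L k)%:R) | <= B.
Proof.
exists (\sum_(k < K) `|b k| * (modulus%:R + 1)); split.
  by apply: sumr_ge0 => k _; rewrite mulr_ge0 // addr_ge0.
move=> n; rewrite cop_count_swap !mulr_sumr -sumrB.
apply: le_trans (ler_norm_sum _ _ _) _; apply: ler_sum => k _.
rewrite (_ : _ - _ = b k * ((cop_count (n %/ L k))%:R - n%:R * cop_density / (L k)%:R));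
  last by ring.
by rewrite normrM ler_wpM2l // cop_count_div // (ell_gt0 G).
Qed.

Lemma sum_min_le n K : \sum_(i < n.+1 | cop i) \sum_(k < minn (fibre_len n i) K) (1 : R) <= n%:R.
Proof.
rewrite -[in leRHS](sum_fibre_len (ltnSn n)) natr_sum; apply: ler_sum => i _.
by rewrite sumr_const card_ord ler_nat geq_minl.
Qed.

(** Truncated fibres occupy at most n of the integers up to n. *)
Lemma cop_density_inv_sum K : cop_density * inv_sum K <= 1.
Proof.
rewrite -subr_le0; have [B [_ hB]] := count_asym (fun=> 1) K.
apply: (@linear_bound_le0 _ _ B) => n.
have := hB n; rewrite ler_norml => /andP[h1 _].
have := sum_min_le n K.
rewrite (_ : \sum_(k < K) 1 / (L k)%:R = inv_sum K) in h1; last first.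
  by apply: eq_bigr => k _; rewrite div1r.
lra.
Qed.

Lemma inv_sum_mono : {homo inv_sum : i j / (i <= j)%N >-> i <= j}.
Proof.
apply: homo_leq => [x|y x z|n]; [exact: lexx | exact: le_trans |].
by rewrite /inv_sum big_ord_recr /= lerDl invr_ge0.
Qed.

Lemma cvg_inv_sum : cvgn inv_sum.
Proof.
apply: nondecreasing_is_cvgn; first exact: inv_sum_mono.
exists cop_density^-1 => _ [n _ <-]; rewrite -div1r ler_pdivlMr ?cop_density_gt0 // mulrC.
exact: cop_density_inv_sum.
Qed.

Local Notation gam := (gammaS R ell).

Lemma gammaS_cvg : inv_sum @ \oo --> gam.
Proof.
suff -> : gam = limn inv_sum by exact: cvg_inv_sum.
have h : (fun n => \sum_(1 <= k < n.+1) (ell k)%:R^-1 : R) = inv_sum.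
  by apply/funext => n; rewrite big_add1 /= big_mkord.
rewrite /gammaS -h; apply: cvg_lim => //.
by rewrite -cvg_shiftS h; exact: cvg_inv_sum.
Qed.

Lemma inv_sum_le K : inv_sum K <= gam.
Proof.
rewrite -(cvg_lim _ gammaS_cvg) //; apply: nondecreasing_cvgn_le; last exact: cvg_inv_sum.
exact: inv_sum_mono.
Qed.

Lemma inv_sum_tail e : 0 < e -> exists K0, forall K, (K0 <= K)%N -> gam - inv_sum K <= e.
Proof.
move=> e0; have /cvgrPdist_le /(_ _ e0) [K0 _ h] := gammaS_cvg.
exists K0 => K KK; have := h K KK; rewrite /= ger0_norm // subr_ge0; exact: inv_sum_le.
Qed.

(** What the truncation at K loses is the sum over k >= K of the counts of
    heads up to n / L k, each at most n / L k. *)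
Lemma tail_count n K :
  n%:R - \sum_(i < n.+1 | cop i) \sum_(k < minn (fibre_len n i) K) (1 : R)
   <= n%:R * (gam - inv_sum K).
Proof.
have kn i : cop i -> minn (fibre_len n i) n = fibre_len n i.
  move=> ci; apply/minn_idPl/(fibre_len_le G); first exact: (cop_gt0 G).
  have := cop_gt0 G ci; have := ell_gtk G n; nia.
rewrite [X in X - _](_ : _ = \sum_(i < n.+1 | cop i) \sum_(k < minn (fibre_len n i) n) (1 : R)); last first.
  rewrite -[in LHS](sum_fibre_len (ltnSn n)) natr_sum; apply: eq_bigr => i ci.
  by rewrite kn // sumr_const card_ord.
rewrite !(cop_count_swap _ _ (fun=> 1)).
have [Kn|nK] := leqP K n; last first.
  apply: (@le_trans _ _ 0); last by rewrite mulr_ge0 // subr_ge0 inv_sum_le.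
  rewrite subr_le0 -(big_mkord xpredT (fun k => 1 * (cop_count (n %/ L k))%:R)).
  rewrite -(big_mkord xpredT (fun k => 1 * (cop_count (n %/ L k))%:R)).
  rewrite [leRHS](big_cat_nat (n := n)) //=; last exact: ltnW.
  by rewrite lerDl sumr_ge0 // => k _; rewrite mulr_ge0.
rewrite -(big_mkord xpredT (fun k => 1 * (cop_count (n %/ L k))%:R)).
rewrite -(big_mkord xpredT (fun k => 1 * (cop_count (n %/ L k))%:R)).
rewrite (big_cat_nat (n := K)) //= addrAC subrr add0r.
apply: (@le_trans _ _ (n%:R * (inv_sum n - inv_sum K))); last first.
  by rewrite ler_wpM2l // lerB // inv_sum_le.
rewrite /inv_sum -(big_mkord xpredT (fun k => (L k)%:R^-1))
  -(big_mkord xpredT (fun k => (L k)%:R^-1)).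
rewrite [X in _ * (X - _)](big_cat_nat (n := K)) //= addrAC subrr add0r mulr_sumr.
apply: ler_sum => k _; rewrite mul1r.
have Lk : 0 < ((L k)%:R : R) by rewrite ltr0n (ell_gt0 G).
rewrite ler_pdivlMr // -natrM ler_nat.
exact: leq_trans (leq_mul (cop_count_leq _) (leqnn _)) (leq_divM _ _).
Qed.

(** The upper bound passes [cop_density_inv_sum] to the limit; for the lower
    bound, the truncated fibres miss at most a fraction gamma - inv_sum K of
    the integers. *)
Lemma cop_density_gamma : cop_density * gam = 1.
Proof.
apply/eqP; rewrite eq_le; apply/andP; split.
  rewrite -ler_pdivlMl ?cop_density_gt0 // mulr1 -(cvg_lim _ gammaS_cvg) //.
  apply: limr_le; first exact: cvg_inv_sum.
  apply: nearW => n; rewrite -div1r ler_pdivlMr ?cop_density_gt0 // mulrC.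
  exact: cop_density_inv_sum.
apply/ler_addgt0Pl => e e0; have [K0 /(_ _ (leqnn _)) hK] := inv_sum_tail e0.
have [B [_ hB]] := count_asym (fun=> 1) K0.
have : 1 - (cop_density * inv_sum K0 + e) <= 0.
  apply: (@linear_bound_le0 _ _ B) => n.
  have := hB n; rewrite ler_norml => /andP[_ h1].
  have h2 := tail_count n K0.
  rewrite (_ : \sum_(k < K0) 1 / (L k)%:R = inv_sum K0) in h1; last first.
    by apply: eq_bigr => k _; rewrite div1r.
  have : n%:R * (gam - inv_sum K0) <= n%:R * e by rewrite ler_wpM2l.
  lra.
have : cop_density * inv_sum K0 <= cop_density * gam
  by rewrite ler_wpM2l ?inv_sum_le // ltW // cop_density_gt0.
lra.
Qed.

Lemma gamma_gt0 : 0 < gam.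
Proof. by rewrite -(pmulr_rgt0 _ cop_density_gt0) cop_density_gamma. Qed.

Lemma gammaV : gam^-1 = cop_density.
Proof.
by have g0 := gt_eqF gamma_gt0; rewrite -[LHS]mul1r -cop_density_gamma mulfK ?g0. Qed.

(** Since ell increases, (K - K0) / ell_K is at most the sum of the 1/ell_k for
    K0 < k <= K, a tail of a convergent series. *)
Lemma cvg_index_over_ell : (fun K => K%:R / (ell K)%:R : R) @ \oo --> (0 : R).
Proof.
apply/cvgrPdist_le => e e0.
have e20 : 0 < e / 2 by rewrite divr_gt0.
have [K0 /(_ _ (leqnn _)) hK] := inv_sum_tail e20.
have [N hN] : exists N : nat, K0%:R / (e / 2) <= N%:R.
  exists (Num.bound (K0%:R / (e / 2))); apply: ltW; apply: archi_boundP.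
  by rewrite divr_ge0 // ltW.
exists (maxn K0 N).+1 => // -[//|K] /=; rewrite ltnS geq_max => /andP[KK KN].
have LK : 0 < ((L K)%:R : R) by rewrite ltr0n (ell_gt0 G).
rewrite sub0r normrN ger0_norm; last by rewrite divr_ge0 // ltW.
have h1 : (K.+1 - K0)%:R / (L K)%:R <= e / 2.
  apply: le_trans hK; apply: (@le_trans _ _ (inv_sum K.+1 - inv_sum K0)); last first.
    by rewrite lerB // inv_sum_le.
  rewrite /inv_sum -(big_mkord xpredT (fun k => (L k)%:R^-1))
    -(big_mkord xpredT (fun k => (L k)%:R^-1)).
  rewrite (big_cat_nat (n := K0)) //=; last exact: leqW.
  rewrite addrAC subrr add0r mulr_natl -sumr_const_nat [leLHS]big_nat_cond [leRHS]big_nat_cond.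
  apply: ler_sum => k /andP[/andP[_ kK] _].
  rewrite lef_pV2 ?posrE ?ltr0n ?(ell_gt0 G) // ler_nat (ell_leE G); lia.
have h2 : K0%:R / (L K)%:R <= e / 2.
  rewrite ler_pdivrMr // mulrC -ler_pdivrMr //; apply: le_trans hN _.
  rewrite ler_nat; have := ell_gtk G K; lia.
have -> : K.+1%:R = (K.+1 - K0)%:R + K0%:R :> R by rewrite -natrD subnK //; lia.
by rewrite mulrDl [e]splitr lerD.
Qed.

End Density.

(** * Cylinders, topology and metric *)

Section Topology.
Context (m : nat).
Implicit Types (x y : Sigma m) (A : set (Sigma m)).

Lemma open_coord k (a : letter m) : open [set x : Sigma m | x k = a].
Proof.
have h : open ((fun x : Sigma m => x k) @^-1` [set a]).
  apply: open_comp; last exact: discrete_open.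
  by move=> x _; apply: (@proj_continuous nat (fun=> discrete_topology (letter m)) k).
by [].
Qed.

Lemma open_agree n y : open [set x | agree n x y].
Proof.
elim: n => [|n IH].
  by rewrite (_ : [set _ | _] = setT); [exact: openT|apply/seteqP; split].
rewrite (_ : [set _ | _] = [set x | agree n x y] `&` [set x | x n = y n]).
  by apply: openI => //; apply: open_coord.
by apply/seteqP; split => x /agreeS.
Qed.

(** Closed sets are determined by their cylinders: the points x of A that agree
    with y up to n converge to y. *)
Lemma closed_agree A y : closed A -> (forall n, exists2 x, A x & agree n x y) -> A y.
Proof.
move=> clA /(_ _)/cid2 h.
pose f n := s2val (h n).
have Af n : A (f n) by exact: s2valP.
have fy n : agree n (f n) y by exact: (s2valP' (h n)).
have fcvg : f @ \oo --> y.
  apply/cvg_sup => N U [V] [[W] oW <-] WyN WU.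
  apply: (filterS WU); exists N.+1 => // n /= Nn.
  by rewrite /preimage /= (fy n N Nn).
apply: clA => B /fcvg [N _ hN]; exists (f N); split; first exact: Af.
exact: hN (leqnn N).
Qed.

Lemma compact_Sigma : compact [set: Sigma m].
Proof.
have h : compact [set: discrete_topology (letter m)].
  apply: finite_compact; exact: (@finite_finset (letter m)).
have := @tychonoff _ (fun _ : nat => discrete_topology (letter m)) _ (fun=> h).
by congr (compact _); rewrite eqEsubset.
Qed.

End Topology.

Section Metric.
Context (R : realType) (m : nat) (m_ge2 : (2 <= m)%N).
Implicit Types (x y : Sigma m) (A : set (Sigma m)).

Lemma m_gt0 : 0 < (m%:R : R). Proof. by rewrite ltr0n; lia. Qed.
Lemma m_gt1 : 1 < (m%:R : R). Proof. by rewrite ltr1n; lia. Qed.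
Lemma lnm_gt0 : 0 < ln (m%:R : R). Proof. by rewrite ln_gt0 // m_gt1. Qed.

Lemma rho_ge0 x y : 0 <= rho R x y.
Proof. by rewrite /rho; case: pselect => // h; rewrite invr_ge0 exprn_ge0. Qed.

Lemma rho_le_agree n x y : rho R x y <= (m%:R ^+ n.+1)^-1 <-> agree n x y.
Proof.
have mg := m_gt1; have m0 := m_gt0; rewrite /rho; case: pselect => [h|h]; last first.
  split=> [_ k _|_]; last by rewrite invr_ge0 exprn_ge0.
  by apply/eqP/negPn/negP => ne; apply: h; exists k.
case: ex_minnP => k ne mink; rewrite lef_pV2 ?posrE ?exprn_gt0 // ler_eXn2l // ltnS.
split=> [nk j jn|ag].
  apply/eqP/negPn/negP => /mink; lia.
rewrite leqNgt; apply/negP => kn; move: ne; by rewrite ag // eqxx.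
Qed.

Lemma rho_le1 x y : rho R x y <= 1.
Proof.
apply: (@le_trans _ _ (m%:R ^+ 1)^-1); first exact/rho_le_agree.
by rewrite expr1 invf_le1 ?m_gt0 // ltW // m_gt1.
Qed.

Let dset A := [set d : R | exists x y, [/\ A x, A y & d = rho R x y]].

Lemma rho_le_diam A x y : A x -> A y -> rho R x y <= diam R A.
Proof.
move=> Ax Ay; apply: ub_le_sup; last by exists x, y.
by exists 1 => _ [x' [y' [_ _ ->]]]; apply: rho_le1.
Qed.

Lemma diam_le A r : 0 <= r -> (forall x y, A x -> A y -> rho R x y <= r) -> diam R A <= r.
Proof.
move=> r0 h; rewrite /diam; have [[d ds]|ne] := pselect (dset A !=set0).
  by apply: ge_sup; [exists d|move=> _ [x [y [Ax Ay ->]]]; apply: h].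
rewrite (_ : mkset _ = set0) ?sup0 //.
by apply/seteqP; split => // d hd; case: ne; exists d.
Qed.

Lemma diam_ge0 A : 0 <= diam R A.
Proof.
rewrite /diam; have [[d ds]|ne] := pselect (dset A !=set0).
  apply: (@le_trans _ _ d); first by case: ds => x [y [_ _ ->]]; apply: rho_ge0.
  apply: ub_le_sup => //; exists 1 => _ [x' [y' [_ _ ->]]]; apply: rho_le1.
rewrite (_ : mkset _ = set0) ?sup0 //.
by apply/seteqP; split => // d hd; case: ne; exists d.
Qed.

Lemma diam_agree_le n A : (forall x y, A x -> A y -> agree n x y) ->
  diam R A <= (m%:R ^+ n.+1)^-1.
Proof.
move=> h; apply: diam_le => [|x y Ax Ay]; first by rewrite invr_ge0 exprn_ge0.
by apply/rho_le_agree/h.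
Qed.

Lemma diam_lt_agree n A x y : diam R A < (m%:R ^+ n)^-1 -> A x -> A y -> agree n x y.
Proof.
case: n => [//|n] dA Ax Ay; apply/rho_le_agree; have := rho_le_diam Ax Ay => h.
have := le_lt_trans h dA; rewrite /rho; case: pselect => [e|_ _]; last first.
  by rewrite invr_ge0 exprn_ge0.
case: ex_minnP => k _ _; rewrite ltf_pV2 ?posrE ?exprn_gt0 ?m_gt0 //.
rewrite ltr_eXn2l ?m_gt1 // => nk.
by rewrite lef_pV2 ?posrE ?exprn_gt0 ?m_gt0 // ler_eXn2l ?m_gt1.
Qed.

Lemma expm n : (m%:R ^+ n)^-1 = expR (- (n%:R * ln m%:R)) :> R.
Proof. by rewrite expRN expRM_natl lnK // posrE m_gt0. Qed.

End Metric.

(** * Two criteria for the Hausdorff measure of a set *)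

Section Tools.
Context (R : realType).

Lemma expR_small (eta e : R) : 0 < eta -> 0 < e ->
  exists N0 : nat, forall n, (N0 <= n)%N -> expR (- (n%:R * eta)) <= e.
Proof.
move=> eta0 e0; exists (Num.bound (`|ln e| / eta)) => n Nn.
rewrite -[leRHS]lnK ?posrE // ler_expR lerNl.
apply: (@le_trans _ _ `|ln e|); first by rewrite lerNl; have := ler_norm (- ln e);
  rewrite normrN; lra.
rewrite -ler_pdivrMr //; apply: ltW;
  apply: lt_le_trans (_ : (Num.bound (`|ln e| / eta))%:R <= _).
  by apply: archi_boundP; rewrite divr_ge0 // ltW.
by rewrite ler_nat.
Qed.

(** The tails are uniformly small: they are dominated by exp(- N0 eta) divided by
    1 - exp(- eta). *)
Lemma geom_tail (eta e : R) : 0 < eta -> 0 < e ->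
  exists N0 : nat, forall N1 N, (N0 <= N1)%N ->
    \sum_(N1 <= n < N) expR (- (n%:R * eta)) <= e.
Proof.
move=> eta0 e0; set q := expR (- eta).
have q0 : 0 < q by exact: expR_gt0.
have q1 : q < 1 by rewrite expR_lt1 // oppr_lt0.
have e10 : 0 < e * (1 - q) by rewrite mulr_gt0 // subr_gt0.
have [N0 hN] := expR_small eta0 e10.
exists N0 => N1 N N01; have [NN|NN] := leqP N N1.
  by rewrite big_geq // ltW.
have -> : \sum_(N1 <= n < N) expR (- (n%:R * eta)) =
    (expR (- (N1%:R * eta)) - expR (- (N%:R * eta))) / (1 - q).
  have q_ne : 1 - q != 0 by rewrite gt_eqF // subr_gt0.
  apply: (mulIf q_ne); rewrite divfK // mulr_suml.
  have := telescope_sumr (fun n => expR (- (n%:R * eta))) (ltnW NN).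
  move=> /(congr1 -%R); rewrite opprB => <-; rewrite -sumrN; apply: eq_bigr => n _.
  rewrite (_ : expR (- (n.+1%:R * eta)) = expR (- (n%:R * eta)) * q); first by ring.
  by rewrite -expRD -natr1; congr expR; ring.
rewrite ler_pdivrMr ?subr_gt0 //; apply: le_trans (hN _ N01).
by rewrite gerDl oppr_le0 expR_ge0.
Qed.

Lemma sum_uniq_sub (T : eqType) (s1 s2 : seq T) (g : T -> R) :
  (forall x, 0 <= g x) -> uniq s1 -> uniq s2 -> {subset s1 <= s2} ->
  \sum_(x <- s1) g x <= \sum_(x <- s2) g x.
Proof.
move=> g0 u1 u2 s12.
have pe : perm_eq s1 [seq x <- s2 | x \in s1].
  apply: uniq_perm => //; first by rewrite filter_uniq.
  by move=> x; rewrite mem_filter; case: (boolP (x \in s1)) => // /s12 ->.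
rewrite (perm_big _ pe) /= big_filter big_mkcond /=.
by apply: ler_sum => x _; case: ifP.
Qed.

Lemma sum_pmap (I T : Type) (f : I -> option T) (g : T -> R) (r : seq I) :
  \sum_(j <- r) oapp g 0 (f j) = \sum_(w <- pmap f r) g w.
Proof.
elim: r => [|j r IH]; first by rewrite !big_nil.
by rewrite big_cons IH /=; case: (f j) => [w|] /=; rewrite ?big_cons ?add0r.
Qed.

End Tools.

Section Criteria.
Context (R : realType) (m : nat) (m_ge2 : (2 <= m)%N).
Implicit Types (x y : Sigma m) (A : set (Sigma m)).

Definition exts (w : seq (letter m)) : Sigma m := fun k => nth (ord0 : letter m) w k.

(** The cylinders of the good words of length at least N0, listed along the
    countable type of all words; [pickle_inv] avoids repetitions. *)
Definition word_set (good : nat -> Sigma m -> bool) (N0 : nat) (j : nat) : set (Sigma m) :=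
  if @pickle_inv (seq (letter m)) j is Some w then
    if (N0 <= size w)%N && good (size w) (exts w) then [set x | agree (size w) x (exts w)] else set0
  else set0.

Lemma diam_set0 : diam R (@set0 (Sigma m)) = 0.
Proof.
apply/eqP; rewrite eq_le diam_ge0 // andbT.
by apply: diam_le.
Qed.

(** Partial sums of the listed cylinders only see words of bounded length, and
    can be regrouped by length because the list has no repetition. *)
Lemma word_set_sum (good : nat -> Sigma m -> bool) N0 s M : 0 < s ->
  exists N, \sum_(0 <= j < M) diam R (word_set good N0 j) `^ s <=
   \sum_(N0 <= n < N) wsum n (fun x => (good n x)%:R) * expR (- (n%:R * (s * ln m%:R))).
Proof.
move=> s0; have mg0 : 0 < (m%:R : R) by exact: m_gt0.
pose g (w : seq (letter m)) : R :=
  if (N0 <= size w)%N && good (size w) (exts w) then expR (- ((size w)%:R * (s * ln m%:R))) else 0.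
have g0 w : 0 <= g w by rewrite /g; case: ifP => // _; exact: expR_ge0.
have s_ne0 : s != 0 by rewrite gt_eqF.
have dg j : diam R (word_set good N0 j) `^ s <= oapp g 0 (@pickle_inv (seq (letter m)) j).
  rewrite /word_set; case: (@pickle_inv (seq (letter m)) j) => [w|] /=;
    last by rewrite diam_set0 powR0.
  rewrite /g; case: ifP => _; last by rewrite diam_set0 powR0.
  apply: (@le_trans _ _ ((m%:R ^+ size w)^-1 `^ s)).
    rewrite ge0_ler_powR ?nnegrE ?diam_ge0 ?invr_ge0 ?exprn_ge0 ?(ltW s0) //.
    apply: le_trans (diam_agree_le R m_ge2 (n := size w) _) _.
      by move=> x y hx hy; apply: agree_trans hx (agree_sym hy).
    rewrite lef_pV2 ?posrE ?exprn_gt0 // ler_eXn2l ?m_gt1 //.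
  by rewrite expm // /powR gt_eqF ?expR_gt0 // expRK mulrCA mulrN.
pose S := pmap (@pickle_inv (seq (letter m))) (iota 0 M).
pose N := (\max_(w <- S) size w).+1.
exists N.
apply: (@le_trans _ _ (\sum_(w <- S) g w)).
  rewrite /S -sum_pmap /index_iota subn0; exact: ler_sum.
have uS : uniq S.
  apply: (@pmap_uniq _ _ _ pickle); [exact: pickle_invK|exact: iota_uniq].
have -> : \sum_(w <- S) g w = \sum_(N0 <= n < N) \sum_(w <- S | size w == n) g w.
  rewrite [RHS](exchange_big_dep xpredT) //= ; apply: eq_big_seq => w wS.
  have wN : (size w < N)%N by rewrite ltnS; apply: (@leq_bigmax_seq _ _ xpredT size).
  have [Nw|wN0] := leqP N0 (size w); last first.
    by have -> : g w = 0; rewrite ?big1 // /g leqNgt wN0.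
  rewrite (big_rem (size w)) ?mem_index_iota ?Nw //= eqxx big_seq_cond big1 ?addr0 //.
  move=> n; rewrite (rem_filter _ (iota_uniq _ _)) mem_filter => /andP[/andP[/= nw _] /eqP e].
  by rewrite e eqxx in nw.
rewrite big_nat_cond [leRHS]big_nat_cond; apply: ler_sum => n /andP[/andP[Nn _] _].
rewrite -wsumZr /wsum.
apply: (@le_trans _ _ (\sum_(w <- [seq tval u | u <- index_enum (n.-tuple (letter m) : finType)]) g w)).
  rewrite -big_filter.
  apply: (@sum_uniq_sub _ (seq (letter m))) => //; first by rewrite filter_uniq.
    by rewrite map_inj_uniq ?index_enum_uniq //; exact: val_inj.
  move=> w; rewrite mem_filter => /andP[sw _].
  by apply/mapP; exists (Tuple sw); rewrite ?mem_index_enum.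
rewrite big_map; apply: ler_sum => u _; rewrite /g size_tuple Nn /=.
by case: ifP => _; rewrite ?mul1r ?mul0r.
Qed.

Lemma hausdorff_ge0 (s : R) A : (0 <= hausdorff_measure s A)%E.
Proof.
apply: (@le_trans _ _ (hausdorff_premeasure s (1:R) A)); last first.
  by apply: ereal_sup_ubound; exists (1:R) => //=; exact: ltr01.
apply: le_ereal_inf_tmp => _ [U _ <-]; apply: nneseries_ge0 => k _ _.
by rewrite lee_fin powR_ge0.
Qed.

(** Covering by heavy cylinders: a level carries at most exp(n sigma) words of mass at
    least exp(- n sigma), and each of them contributes at most exp(- n s ln m). *)
Lemma hausdorff_eq0 (X : set (Sigma m)) (P : nat -> Sigma m -> R) s sigma :
  0 < s -> sigma < s * ln m%:R ->
  (forall n, local n (P n)) -> (forall n x, 0 <= P n x) -> (forall n, wsum n (P n) <= 1) ->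
  (forall x N0, X x -> exists2 n, (N0 <= n)%N & expR (- (n%:R * sigma)) <= P n x) ->
  hausdorff_measure s X = 0%E.
Proof.
move=> s0 hsig lP P0 P1 hP.
apply/eqP; rewrite eq_le hausdorff_ge0 andbT; apply: ge_ereal_sup => _ [delta /= d0 <-].
apply/lee_addgt0Pr => e e0; rewrite add0e.
have eta0 : 0 < s * ln m%:R - sigma by rewrite subr_gt0.
have [N1 hN1] := geom_tail eta0 e0.
have [N2 hN2] := expR_small (lnm_gt0 R m_ge2) d0.
pose N0 := maxn N1 N2.
pose good n x := expR (- (n%:R * sigma)) <= P n x.
apply: ge_ereal_inf; exists (\sum_(0 <= i <oo) (diam R (word_set good N0 i) `^ s)%:E)%E.
  exists (word_set good N0) => //; split.
    move=> x /(hP x N0)[n Nn gn].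
    exists (pickle (tval (trunc n x))) => //.
    rewrite /word_set pickleK_inv size_tuple Nn /= /good.
    have ag : agree n (exts (trunc n x)) x by exact: ext_trunc.
    by rewrite (lP n _ _ ag) gn /=; apply: agree_sym.
  move=> j; rewrite /word_set; case: (@pickle_inv (seq (letter m)) j) => [w|];
    last by rewrite diam_set0 ltW.
  case: ifP => [/andP[Nw _]|_]; last by rewrite diam_set0 ltW.
  apply: le_trans (hN2 (size w).+1 _).
    rewrite -expm //; apply: diam_agree_le => // x y hx hy.
    by apply: agree_trans hx (agree_sym hy).
  by apply: leqW; apply: leq_trans Nw; exact: leq_maxr.
apply: lime_le; first by apply: is_cvg_nneseries => n _ _; rewrite lee_fin powR_ge0.
apply: nearW => M; rewrite sumEFin lee_fin.
have [N hN] := @word_set_sum good N0 s M s0.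
apply: le_trans hN _; apply: le_trans (hN1 N0 N (leq_maxl _ _)).
apply: ler_sum => n _.
rewrite (_ : - (n%:R * (s * ln m%:R - sigma)) = n%:R * sigma + - (n%:R * (s * ln m%:R)));
  last by ring.
rewrite expRD ler_wpM2r ?expR_ge0 //.
rewrite -[leRHS]mulr1 -ler_pdivrMl ?expR_gt0 //.
apply: le_trans (P1 n); rewrite -wsumZ; apply: wsum_le => x.
rewrite -expRN /good; case: (boolP (expR (- (n%:R * sigma)) <= P n x)) => h;
  first by rewrite mulr1.
by rewrite mulr0.
Qed.

End Criteria.

Section Lower.
Context (R : realType) (m : nat) (m_ge2 : (2 <= m)%N).
Implicit Types (x y : Sigma m) (A : set (Sigma m)).

Lemma open_local (T : Type) n (g : Sigma m -> T) c : local n g -> open [set x | g x = c].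
Proof.
move=> lg; rewrite (_ : [set _ | _] = \bigcup_(y in [set y | g y = c]) [set x | agree n x y]).
  by apply: bigcup_open => y _; exact: open_agree.
apply/seteqP; split => [x gx|x [y /= gy xy]]; first by exists x.
by rewrite /= (lg _ _ xy).
Qed.

Lemma local_agree n y : local n (fun x => (`[< agree n x y >])%:R : R).
Proof.
move=> x x' xx'; congr (nat_of_bool _)%:R; apply: asbool_equiv_eq.
by split; apply: agree_trans => //; apply: agree_sym.
Qed.

Lemma wsum_point n (g : Sigma m -> R) y : local n g ->
  wsum n (fun x => g x * (`[< agree n x y >])%:R) = g y.
Proof.
move=> lg; have := congr1 (fun c => g y * c) (wsum_indic R n y).
rewrite mulr1 => <-; rewrite -wsumZ; apply: eq_wsum => x.
by case: asboolP => [/lg ->|_] /=; rewrite ?mulr1 ?mulr0.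
Qed.

(** A set of diameter D lies in a cylinder whose diameter is comparable to D. For
    D = 0 no cylinder is comparable, and the error term e pays for a long one. *)
Lemma cylinder_length s (D e : R) N0 : 0 < s -> 0 <= D -> D <= (m%:R ^+ N0.+1)^-1 -> 0 < e ->
  exists n, [/\ (N0 <= n)%N, D < (m%:R ^+ n)^-1 &
    expR (- (n%:R * (s * ln m%:R))) <= expR (s * ln m%:R) * D `^ s + e].
Proof.
move=> s0 D0 DN e0; have mg0 := m_gt0 R m_ge2; have mg1 := m_gt1 R m_ge2.
have DN0 : D < (m%:R ^+ N0)^-1.
  apply: le_lt_trans DN _; rewrite ltf_pV2 ?posrE ?exprn_gt0 // ltr_eXn2l //.
pose Q n := (N0 <= n)%N && ((m%:R ^+ n.+1)^-1 <= D).
have [exQ|nexQ] := pselect (exists n, Q n); last first.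
  have eta0 : 0 < s * ln m%:R by rewrite mulr_gt0 // lnm_gt0.
  have [N1 hN] := expR_small eta0 e0.
  exists (maxn N0 N1).+1; split; first by rewrite leqW // leq_maxl.
    rewrite ltNge; apply/negP => h; apply: nexQ; exists (maxn N0 N1).
    by rewrite /Q leq_maxl.
  apply: le_trans (hN _ _) _; first by rewrite leqW // leq_maxr.
  by rewrite lerDr mulr_ge0 ?expR_ge0 ?powR_ge0.
case: (ex_minnP exQ) => n /andP[Nn hn] minn; exists n; split => //.
  move: Nn; rewrite leq_eqVlt => /orP[/eqP <- //|]; case: n hn minn => // n hn minn Nn.
  rewrite ltNge; apply/negP => h; have := minn n; rewrite /Q h andbT -ltnS Nn => /(_ isT).
  by rewrite ltnn.
apply: (@le_trans _ _ (expR (s * ln m%:R) * D `^ s)); last by rewrite lerDl ltW.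
rewrite (_ : - (n%:R * _) = s * ln m%:R + - (n.+1%:R * (s * ln m%:R)));
  last by rewrite -natr1; ring.
rewrite expRD ler_wpM2l ?expR_ge0 //.
apply: (@le_trans _ _ ((m%:R ^+ n.+1)^-1 `^ s)); last first.
  by rewrite ge0_ler_powR ?nnegrE ?invr_ge0 ?exprn_ge0 ?(ltW s0) // ltW.
by rewrite expm // /powR gt_eqF ?expR_gt0 // expRK mulrCA mulrN.
Qed.

Lemma half_sum M : \sum_(j < M) ((2 ^+ j.+3)^-1 : R) <= 1 / 4.
Proof.
suff -> : \sum_(j < M) ((2 ^+ j.+3)^-1 : R) = 1 / 4 - (2 ^+ M.+2)^-1.
  by rewrite gerBl invr_ge0 exprn_ge0.
elim: M => [|M IH]; first by rewrite big_ord0 !exprS expr0; field.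
rewrite big_ord_recr /= IH [2 ^+ M.+3]exprS.
have : 0 < (2 : R) ^+ M.+2 by rewrite exprn_gt0.
by set q := 2 ^+ _ => q0; field; rewrite gt_eqF.
Qed.

(** Mass distribution principle. The cylinders on which the mass exceeds the
    expected size are given away: they carry at most half of the total. *)
Lemma hausdorff_neq0 (X : set (Sigma m)) (P : nat -> Sigma m -> R) (s : R) N0 :
  0 < s -> consistent P -> (forall x, (forall n, 0 < P n x) -> X x) ->
  (forall N, \sum_(N0 <= n < N)
     wsum n (fun x => P n x * (expR (- (n%:R * (s * ln m%:R))) < P n x)%R%:R) <= 1 / 2) ->
  hausdorff_measure s X <> 0%E.
Proof.
move=> s0 cP PX hbad H0; have mg0 := m_gt0 R m_ge2; have [lP P0 _ _] := cP.
set sigma := s * ln m%:R in hbad.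
(* 1/8 from the diameters, 1/4 from the error terms and 1/2 from the heavy
   cylinders leave the total mass 1 uncovered *)
pose c := expR (- sigma) / 8.
have c0 : 0 < c by rewrite divr_gt0 ?expR_gt0.
have : (hausdorff_premeasure s ((m%:R ^+ N0.+1)^-1) X < c%:E)%E.
  apply: (@le_lt_trans _ _ 0%E); last by rewrite lte_fin.
  rewrite -H0; apply: ereal_sup_ubound; exists ((m%:R ^+ N0.+1)^-1) => //=.
  by rewrite invr_gt0 exprn_gt0.
move=> /ereal_inf_lt[_ [U [XU dU] <-]] hU.
have hUM M : \sum_(0 <= j < M) diam R (U j) `^ s <= c.
  rewrite -lee_fin -sumEFin; apply: le_trans (ltW hU).
  by apply: nneseries_lim_ge => k _ _; rewrite lee_fin powR_ge0.
have /choice[nn hn] j := cylinder_length s0 (diam_ge0 R m_ge2 (U j)) (dU j)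
   (ltac:(by rewrite invr_gt0 exprn_gt0) : 0 < (2 ^+ j.+3)^-1 :> R).
have /choice[y hy] j : exists y, forall x, U j x -> agree (nn j) x y.
  have [_ dj _] := hn j.
  have [[y Uy]|ne] := pselect (exists y, U j y); last first.
    by exists (fun=> ord0) => x Ux; case: ne; exists x.
  by exists y => x Ux; apply: diam_lt_agree dj Ux Uy.
(* Null cylinders are added to the cover: they account for the points
   outside X, so that the whole compact space of sequences is covered. *)
have [D' _ hD'] : finite_subset_cover [set: nat]
    (fun j => [set x | agree (nn j) x (y j)] `|` [set x | P j x = 0]) [set: Sigma m].
  have := @compact_Sigma m; rewrite compact_cover; apply.
    by move=> j _; apply: openU; [exact: open_agree|apply: open_local (lP j)].
  move=> x _; have [[n Pn]|nex] := pselect (exists n, P n x = 0); first by exists n => //;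
    right.
  have /XU[j _ Uj] : X x.
    apply: PX => n; rewrite lt_neqAle P0 andbT eq_sym; apply/eqP => Pn; apply: nex;
      by exists n.
  by exists j => //; left; apply: hy.
pose M := (\max_(j <- finmap.enum_fset D') j).+1.
have hM x : exists2 j, (j < M)%N & agree (nn j) x (y j) \/ P j x = 0.
  have [j jD hj] := hD' x I; exists j => //.
  by rewrite ltnS; apply: (@leq_bigmax_seq _ _ xpredT id).
(* a level that refines all the cylinders of the finite cover *)
pose N := maxn M (\max_(j < M) nn j).
have MN : (M <= N)%N by exact: leq_maxl.
have nN j : (j < M)%N -> (nn j <= N)%N.
  move=> jM; apply: leq_trans (leq_maxr _ _).
  exact: (@leq_bigmax _ (fun j : 'I_M => nn j) (Ordinal jM)).
pose bad n x := expR (- (n%:R * sigma)) < P n x.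
pose Ind j x : R := (`[< agree (nn j) x (y j) >])%:R.
have Ind0 j x : 0 <= Ind j x by [].
have key x : P N x <= \sum_(j < M | ~~ bad (nn j) (y j)) P N x * Ind j x
    + \sum_(N0 <= n < N.+1) P N x * (bad n x)%:R.
  have [j jM [ag|Pj]] := hM x; last first.
    have PN0 : P N x <= 0.
      by rewrite -Pj; apply: consistent_le cP _; apply: leq_trans MN; exact: ltnW.
    apply: le_trans PN0 _; rewrite addr_ge0 // sumr_ge0 // => i _; rewrite mulr_ge0 //.
  have [b|nb] := boolP (bad (nn j) (y j)).
    rewrite ler_wpDl ?sumr_ge0 //; first by move=> i _; rewrite mulr_ge0.
    rewrite (big_rem (nn j)) /=; last first.
      by rewrite mem_index_iota ltnS nN // andbT; case: (hn j).
    have -> : bad (nn j) x by move: b; rewrite /bad (lP _ _ _ ag).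
    by rewrite mulr1 lerDl sumr_ge0 // => i _; rewrite mulr_ge0.
  rewrite ler_wpDr ?sumr_ge0 //; first by move=> i _; rewrite mulr_ge0.
  rewrite (bigD1 (Ordinal jM)) //= /Ind asboolT // mulr1 lerDl sumr_ge0 // => i _.
  by rewrite mulr_ge0.
have := wsum_le N key; rewrite consistent_wsum1 // wsumD !wsum_sum.
have lbad n : local n (fun x => (bad n x)%:R : R).
  by move=> x x' xx'; rewrite /bad (lP _ _ _ xx').
have -> : \sum_(N0 <= n < N.+1) wsum N (fun x => P N x * (bad n x)%:R)
   = \sum_(N0 <= n < N.+1) wsum n (fun x => P n x * (bad n x)%:R).
  rewrite big_nat_cond [RHS]big_nat_cond; apply: eq_bigr => n /andP[/andP[_ nN1] _].
  exact: consistent_wsum.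
have h1 : \sum_(j < M | ~~ bad (nn j) (y j)) wsum N (fun x => P N x * Ind j x)
   <= \sum_(j < M) (expR sigma * diam R (U j) `^ s + (2 ^+ j.+3)^-1).
  rewrite [leLHS]big_mkcond /=; apply: ler_sum => j _; case: ifPn => [nb|_]; last first.
    by rewrite addr_ge0 ?mulr_ge0 ?expR_ge0 ?powR_ge0 ?invr_ge0 ?exprn_ge0.
  rewrite (consistent_wsum cP (@local_agree (nn j) (y j)) (nN _ (ltn_ord j))) wsum_point //.
  have [_ _ hj] := hn j; apply: le_trans hj; by rewrite leNgt.
have h2 : \sum_(j < M) (expR sigma * diam R (U j) `^ s + (2 ^+ j.+3)^-1) <= 1 / 8 + 1 / 4.
  rewrite big_split /=; apply: lerD (half_sum M).
  rewrite -mulr_sumr -(big_mkord xpredT (fun j => diam R (U j) `^ s)).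
  apply: le_trans (ler_wpM2l (expR_ge0 _) (hUM M)) _.
  by rewrite /c mulrA -expRD subrr expR0.
have h3 := hbad N.+1.
move=> h4; have : (1 : R) <= 1 / 8 + 1 / 4 + 1 / 2.
  by apply: le_trans h4 _; apply: lerD h3; apply: le_trans h1 h2.
lra.
Qed.

End Lower.

(** * Lower bound: large deviations of the product mass *)

Section Powers.
Context (R : realType) (t : R).

(** The power u^(1+t), extended by 0 at u = 0 so that it is multiplicative on all
    nonnegative numbers. *)
Definition tilt (u : R) : R := u * expR (t * ln u).

Lemma tilt_ge0 u : 0 <= u -> 0 <= tilt u.
Proof. by move=> u0; rewrite mulr_ge0 ?expR_ge0. Qed.

Lemma tiltM u v : 0 <= u -> 0 <= v -> tilt (u * v) = tilt u * tilt v.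
Proof.
rewrite le_eqVlt => /orP[/eqP <-|u0]; first by rewrite /tilt !mul0r.
rewrite le_eqVlt => /orP[/eqP <-|v0]; first by rewrite /tilt mulr0 !mul0r mulr0.
by rewrite /tilt lnM ?posrE // mulrDr expRD; ring.
Qed.

Lemma tilt_prod (I : Type) (r : seq I) (Q : pred I) (F : I -> R) :
  (forall i, 0 <= F i) -> tilt (\prod_(i <- r | Q i) F i) = \prod_(i <- r | Q i) tilt (F i).
Proof.
move=> F0; have [] // : 0 <= \prod_(i <- r | Q i) F i /\
   tilt (\prod_(i <- r | Q i) F i) = \prod_(i <- r | Q i) tilt (F i).
apply: (big_rec2 (fun x y => 0 <= x /\ tilt x = y)) => [|i x y Qi [x0 <-]].
  by rewrite /tilt ln1 mulr0 expR0 mulr1.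
by rewrite mulr_ge0 // tiltM.
Qed.

Lemma tilt_le u : 0 <= t -> 0 <= u <= 1 -> tilt u <= u.
Proof.
move=> t0 /andP[u0 u1]; rewrite ler_piMr // -expR0 ler_expR.
by rewrite mulr_ge0_le0 // ln_le0.
Qed.

Lemma expRN_le (z : R) : 0 <= z -> expR (- z) <= 1 - z + z ^+ 2.
Proof.
move=> z0; rewrite expRN -div1r ler_pdivrMr ?expR_gt0 //.
have h1 := expR_ge1Dx z.
have h2 : 0 <= 1 - z + z ^+ 2 by nra.
apply: (@le_trans _ _ ((1 - z + z ^+ 2) * (1 + z))); last by rewrite ler_wpM2l.
have h3 : 0 <= z ^+ 3 by rewrite exprn_ge0.
have -> : (1 - z + z ^+ 2) * (1 + z) = 1 + z ^+ 3 by ring.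
by rewrite lerDl.
Qed.

(** Second-order expansion of u^(1+t) in t: the linear term produces the entropy. *)
Lemma tilt_quad u : 0 <= t -> 0 <= u <= 1 ->
  tilt u <= u + t * (u * ln u) + t ^+ 2 * (u * ln u ^+ 2).
Proof.
move=> t0 /andP[u0 u1].
have z0 : 0 <= - (t * ln u) by rewrite -mulrN mulr_ge0 // oppr_ge0 ln_le0.
have := expRN_le z0; rewrite opprK sqrrN => h.
rewrite /tilt; apply: le_trans (ler_wpM2l u0 h) _.
by rewrite le_eqVlt; apply/orP; left; apply/eqP; ring.
Qed.

End Powers.

Section Abel.
Context (R : realType) (ell : nat -> nat).

Definition wt k : R := (ell k)%:R^-1 - (ell k.+1)%:R^-1.

(** Passes from the increments of a to its values; the boundary term a K / ell K
    is what a truncation at level K leaves. *)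
Lemma abel (a : nat -> R) K : a 0%N = 0 ->
  \sum_(k < K) (a k.+1 - a k) / (ell k.+1)%:R =
  \sum_(1 <= k < K) a k * wt k + a K / (ell K)%:R.
Proof.
move=> a0; elim: K => [|K IH]; first by rewrite big_ord0 big_geq // a0 mul0r addr0.
rewrite big_ord_recr /= IH; case: K {IH} => [|K].
  by rewrite !big_geq // a0 subr0 mul0r !add0r.
by rewrite [in RHS]big_nat_recr //= /wt; ring.
Qed.

End Abel.

Section Entropies.
Context (R : realType) (m : nat).

(** Natural logarithms keep the factor 1 / ln m out of all estimates. *)
Definition level_entropy (f : nat -> Sigma m -> R) k : R :=
  - wsum k (fun y => f k y * ln (f k y)).

Lemma level_entropy0 f : consistent f -> level_entropy f 0 = 0.
Proof. by move=> [_ _ f1 _]; rewrite /level_entropy wsum0 f1 ln1 mulr0 oppr0. Qed.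

Lemma level_entropy_ge0 f k : consistent f -> 0 <= level_entropy f k.
Proof.
move=> cf; rewrite /level_entropy -wsumN; apply: wsum_ge0 => y.
have [_ f0 _ _] := cf; rewrite -mulrN mulr_ge0 // oppr_ge0 ln_le0 //.
exact: consistent_le1.
Qed.

End Entropies.

Section Chernoff.
Context (J : nat) (p : 'I_J -> nat) (ell : nat -> nat).
Context (G : generated p ell) (R : realType) (m : nat) (m_ge2 : (2 <= m)%N).
Local Notation L k := (ell k.+1).
Local Notation cop := (cop p).
Local Notation fibre_len := (fibre_len ell).
Local Notation res := (restr_iS ell).
Local Notation d := (cop_density p R).

Lemma count_telescope (a : nat -> R) K n :
  \sum_(i < n.+1 | cop i) \sum_(k < minn (fibre_len n i) K) (a k.+1 - a k) =
  \sum_(i < n.+1 | cop i) (a (minn (fibre_len n i) K) - a 0%N).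
Proof.
apply: eq_bigr => i _; rewrite -(big_mkord xpredT (fun k => a k.+1 - a k)).
by rewrite telescope_sumr.
Qed.

(** Truncating at level K turns the sum over the fibres into a finite combination
    of counts of heads. *)
Lemma count_asym_wt (a : nat -> R) K : a 0%N = 0 -> exists B, 0 <= B /\ forall n,
  `| \sum_(i < n.+1 | cop i) a (minn (fibre_len n i) K)
    - n%:R * (d * (\sum_(1 <= k < K) a k * wt R ell k + a K / (ell K)%:R)) | <= B.
Proof.
move=> a0; have [B [B0 hB]] := count_asym G (fun k => a k.+1 - a k) K.
exists B; split => // n; have := hB n; rewrite count_telescope abel // a0.
by under eq_bigr do rewrite subr0.
Qed.

(** A cylinder of positive mass has positive mass along each of its fibres. *)
Lemma fibre_mass_support (f : nat -> Sigma m -> R) (Omega : set (Sigma m)) x : consistent f ->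
  (forall y, (forall k, 0 < f k y) -> Omega y) ->
  (forall n, 0 < fibre_mass p ell f n x) -> X_set p ell Omega x.
Proof.
move=> cf fO Px i i0 /copP ci; apply: fO => k; have [_ f0 _ _] := cf.
pose n := (i * L k)%N.
have : f (fibre_len n i) (res x i) != 0.
  apply/eqP => e; have := Px n; rewrite /fibre_mass.
  have iN : (i < n.+1)%N by rewrite ltnS leq_pmulr // (ell_gt0 G).
  by rewrite (bigD1 (Ordinal iN)) //= e mul0r ltxx.
move=> ne; apply: lt_le_trans (consistent_le _ cf _ : f (fibre_len n i) (res x i) <= _).
  by rewrite lt_neqAle eq_sym ne /=.
by apply: ltnW; rewrite (ltn_fibre_len G).
Qed.

(** Markov's inequality for the t-th power of the mass. After factoring over the
    fibres, the exponent per unit length is t (sigma - d E) + O(t^2), with E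
    the weighted sum of the first entropies, negative for small t > 0. *)
Lemma chernoff (f : nat -> Sigma m -> R) (sigma : R) K : consistent f ->
  sigma < d * \sum_(1 <= k < K) level_entropy f k * wt R ell k ->
  exists N0, forall N, \sum_(N0 <= n < N)
     wsum n (fun x => fibre_mass p ell f n x *
       (expR (- (n%:R * sigma)) < fibre_mass p ell f n x)%R%:R) <= 1 / 2.
Proof.
move=> cf; set E := \sum_(1 <= k < K) _ => hE; have [lf f0 f1 _] := cf.
pose V k : R := wsum k (fun y => f k y * ln (f k y) ^+ 2).
pose C : R := \sum_(1 <= k < K) `|V k * wt R ell k|.
have d0 : 0 < d := cop_density_gt0 G R.
have C0 : 0 <= C by apply: sumr_ge0.
pose g := d * E - sigma; have g0 : 0 < g by rewrite subr_gt0.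
have dC : 0 < 2 * (d * C + 1) by rewrite mulr_gt0 // ltr_wpDl // mulr_ge0 // ltW.
(* t is small enough for the quadratic term to absorb at most half of the gap *)
have [t t0 tC] : exists2 t, 0 < t & t * (d * C) <= g / 2.
  exists (g / (2 * (d * C + 1))); first by rewrite divr_gt0.
  by rewrite mulrAC ler_pdivrMr //; nra.
pose a k : R := if (k < K)%N then - t * level_entropy f k + t ^+ 2 * V k else 0.
have a0 : a 0%N = 0.
  by rewrite /a; case: ifP => // _;
    rewrite level_entropy0 // /V wsum0 f1 ln1 expr0n /= !mulr0 addr0.
have [B [B0 hB]] := count_asym_wt K a0.
have ff k y : 0 <= f k y <= 1 by rewrite f0 consistent_le1.
have Za k : wsum k (fun y => tilt t (f k y)) <= expR (a k).
  rewrite /a; case: ifP => kK.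
    apply: (@le_trans _ _ (1 + (- t * level_entropy f k + t ^+ 2 * V k)));
      last exact: expR_ge1Dx.
    apply: le_trans (wsum_le _ (fun y => tilt_quad (ltW t0) (ff k y))) _.
    rewrite !wsumD !wsumZ consistent_wsum1 // /level_entropy /V mulrNN addrA; exact: lexx.
  rewrite expR0 -(consistent_wsum1 k cf); apply: wsum_le => y.
  by apply: tilt_le => //; exact: ltW.
have aK : a K = 0 by rewrite /a ltnn.
have amin k : a (minn k K) = a k.
  by have [//|Kk] := leqP k K; rewrite aK /a ltnNge (ltnW Kk).
have step n : wsum n (fun x => fibre_mass p ell f n x *
       (expR (- (n%:R * sigma)) < fibre_mass p ell f n x)%R%:R) <= expR B * expR (- (n%:R * (t * (g / 2)))).
  apply: (@le_trans _ _ (expR (t * (n%:R * sigma)) * wsum n (fun x => tilt t (fibre_mass p ell f n x)))).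
    rewrite -wsumZ; apply: wsum_le => x; have cP := fibre_mass_consistent G cf.
    have P0 : 0 <= fibre_mass p ell f n x by case: cP.
    case: (boolP (expR (- (n%:R * sigma)) < fibre_mass p ell f n x)) => h; last first.
      by rewrite mulr0 mulr_ge0 ?expR_ge0 // tilt_ge0.
    rewrite mulr1 /tilt mulrCA -expRD ler_peMr // -[leLHS]expR0 ler_expR -mulrDr mulr_ge0 ?(ltW t0) //.
    have Pp := lt_trans (expR_gt0 _) h.
    rewrite -(opprK (n%:R * sigma)) addrC subr_ge0.
    by rewrite -ler_expR lnK ?posrE // ltW.
  have -> : wsum n (fun x => tilt t (fibre_mass p ell f n x)) =
      \prod_(i < n.+1 | cop i) wsum (fibre_len n i) (fun y => tilt t (f (fibre_len n i) y)).
    rewrite -(wsum_prod G (F := fun i y => tilt t (f (fibre_len n i) y))) //.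
      by apply: eq_wsum => x; rewrite /fibre_mass tilt_prod.
    by move=> i ci x y xy; rewrite (lf _ _ _ xy).
  have hp : \prod_(i < n.+1 | cop i) wsum (fibre_len n i) (fun y => tilt t (f (fibre_len n i) y))
     <= expR (\sum_(i < n.+1 | cop i) a (minn (fibre_len n i) K)).
    rewrite expR_sum; apply: ler_prod => i ci; rewrite amin Za andbT.
    by apply: wsum_ge0 => y; rewrite tilt_ge0.
  apply: le_trans (ler_wpM2l (expR_ge0 _) hp) _.
  rewrite -!expRD ler_expR.
  have := hB n; rewrite ler_norml aK mul0r addr0 => /andP[_ h].
  have eS : \sum_(1 <= k < K) a k * wt R ell k <= - t * E + t ^+ 2 * C.
    rewrite /E /C !mulr_sumr -big_split /= !big_nat; apply: ler_sum => k /andP[_ kK].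
    rewrite /a kK mulrDl -!mulrA lerD2l.
    by rewrite !ler_wpM2l ?(ltW t0) // ler_norm.
  have n0 : 0 <= (n%:R : R) by [].
  have hd : d * \sum_(1 <= k < K) a k * wt R ell k <= t * (- (d * E) + g / 2).
    apply: le_trans (ler_wpM2l (ltW d0) eS) _.
    rewrite [leLHS](_ : _ = t * (- (d * E) + t * (d * C))); last by ring.
    by rewrite ler_wpM2l ?(ltW t0) // lerD2l.
  have hn := ler_wpM2l n0 hd.
  have e1 : n%:R * (t * (- (d * E) + g / 2)) = - (t * (n%:R * sigma)) - n%:R * (t * (g / 2)).
    by rewrite /g; field.
  lra.
have eta0 : 0 < t * (g / 2) by rewrite mulr_gt0 // divr_gt0.
have e0 : 0 < 1 / 2 / expR B by rewrite divr_gt0 ?expR_gt0.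
have [N0 hN0] := geom_tail eta0 e0.
exists N0 => N; apply: le_trans (ler_sum _ (fun n _ => step n)) _.
rewrite -mulr_sumr mulrC -ler_pdivlMr ?expR_gt0 //; exact: hN0.
Qed.

Lemma hausdorff_neq0_entropy (f : nat -> Sigma m -> R) (Omega : set (Sigma m)) (s : R) K : 0 <
  s -> consistent f ->
  (forall y, (forall k, 0 < f k y) -> Omega y) ->
  s * ln m%:R < d * \sum_(1 <= k < K) level_entropy f k * wt R ell k ->
  hausdorff_measure s (X_set p ell Omega) <> 0%E.
Proof.
move=> s0 cf fO hs; have [N0 hN0] := chernoff cf hs.
apply: (hausdorff_neq0 m_ge2 s0 (fibre_mass_consistent G cf) _ hN0).
by move=> x; apply: fibre_mass_support.
Qed.

End Chernoff.

(** * Upper bound: the optimal weights and logarithmic averaging *)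

Section LogAverage.
Context (R : realType).

(** The weights 1/(n(n+1)) are those for which averaging quantities of size n is
    harmonic averaging, and whose tails are 1/r - 1/T exactly. *)
Definition log_weight (n : nat) : R := (n%:R * n.+1%:R)^-1.

Definition log_weight_tail T r : R := \sum_(1 <= n < T | (r <= n)%N) log_weight n.

Lemma log_weight_ge0 n : 0 <= log_weight n.
Proof. by rewrite invr_ge0 mulr_ge0. Qed.

Lemma log_weightE n : (0 < n)%N -> log_weight n = n%:R^-1 - n.+1%:R^-1.
Proof.
move=> n0; have h : (n%:R : R) != 0 by rewrite pnatr_eq0 -lt0n.
have h' : (n.+1%:R : R) != 0 by rewrite pnatr_eq0.
rewrite /log_weight -natr1; rewrite -natr1 in h'; field; by rewrite h h'.
Qed.

Lemma log_weight_tail_eq T r : (0 < r)%N -> (r <= T)%N ->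
  log_weight_tail T r = r%:R^-1 - T%:R^-1.
Proof.
move=> r0 rT; rewrite /log_weight_tail (big_cat_nat (n := r)) //=.
rewrite big_nat_cond big1 ?add0r; last by move=> n /andP[/andP[_ nr]]; rewrite leqNgt nr.
rewrite big_nat_cond (eq_bigl (fun n => (r <= n < T)%N)); last first.
  by move=> n; case: (r <= n)%N; rewrite ?andbT ?andbF.
rewrite -big_nat; rewrite -[RHS]opprB -(telescope_sumr (fun n => n%:R^-1)) // -sumrN.
rewrite !big_nat; apply: eq_bigr => n /andP[rn _].
by rewrite log_weightE ?opprB // (leq_trans r0).
Qed.

Lemma log_weight_tail_gt T r : (T <= r)%N -> log_weight_tail T r = 0.
Proof.
move=> Tr; rewrite /log_weight_tail big_nat_cond big1 // => n /andP[/andP[_ nT] rn].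
by move: (leq_trans Tr rn); rewrite leqNgt nT.
Qed.

Lemma log_weight_tail_ge0 T r : 0 <= log_weight_tail T r.
Proof. by apply: sumr_ge0 => n _; exact: log_weight_ge0. Qed.

(** The product r (1/r - 1/T) = 1 - r/T decreases in r. *)
Lemma log_weight_tail_mono T r r' : (0 < r)%N -> (r <= r')%N ->
  r'%:R * log_weight_tail T r' <= r%:R * log_weight_tail T r.
Proof.
move=> r0 rr'; have [Tr'|r'T] := leqP T r'.
  by rewrite (log_weight_tail_gt Tr') mulr0 mulr_ge0 // log_weight_tail_ge0.
have r'0 : (0 < r')%N by lia.
have T0 : (0 < T)%N by lia.
rewrite !log_weight_tail_eq //; [|by lia|by lia].
rewrite !mulrBr !divff ?pnatr_eq0 -?lt0n // lerD2l lerN2.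
by rewrite ler_wpM2r ?invr_ge0 // ler_nat.
Qed.

(** If v n <= - eta n eventually, then the weighted sums are at most a constant
    minus eta times a harmonic sum. *)
Lemma log_average (v : nat -> R) (eta : R) N1 : 0 < eta -> (0 < N1)%N ->
  (forall n, (N1 <= n)%N -> v n <= - (eta * n%:R)) ->
  (forall T, 0 <= \sum_(1 <= n < T) log_weight n * v n) -> False.
Proof.
move=> eta0 N10 hv hT; apply: (@dvg_harmonic R).
pose C := \sum_(1 <= n < N1) log_weight n * v n.
have mono : {homo series (@harmonic R) : i j / (i <= j)%N >-> i <= j}.
  apply: nondecreasing_series => n _ _; exact: harmonic_ge0.
apply: nondecreasing_is_cvgn => //.
exists (series harmonic N1 + C / eta) => _ [T _ <-].
apply: (@le_trans _ _ (series harmonic (maxn T N1))).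
  by apply: mono; exact: leq_maxl.
set T' := maxn T N1; have NT : (N1 <= T')%N by exact: leq_maxr.
rewrite /series /= (big_cat_nat (n := N1)) //= lerD2l ler_pdivlMr // mulrC mulr_sumr.
have := hT T'; rewrite (big_cat_nat (n := N1)) //= -/C -lerBlDr sub0r.
rewrite -sumrN => /(le_trans _); apply; rewrite !big_nat; apply: ler_sum => n /andP[Nn _].
have n0 : (n%:R : R) != 0 by rewrite pnatr_eq0; lia.
have n1 : (n.+1%:R : R) != 0 by rewrite pnatr_eq0.
rewrite -mulrN; apply: (@le_trans _ _ (log_weight n * (eta * n%:R))).
  rewrite /log_weight /harmonic /= [leRHS]mulrC -mulrA ler_wpM2l ?(ltW eta0) //.
  by rewrite invfM mulrA mulfV // mul1r.
by rewrite ler_wpM2l ?log_weight_ge0 // lerNr hv.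
Qed.

End LogAverage.

Section Optimal.
Context (J : nat) (p : 'I_J -> nat) (ell : nat -> nat).
Context (G : generated p ell) (R : realType) (m : nat) (m_ge2 : (2 <= m)%N).
Context (Omega : set (Sigma m)) (Omega_neq0 : Omega !=set0) (K : nat).
Local Notation L k := (ell k.+1).
Local Notation cop := (cop p).
Local Notation fibre_len := (fibre_len ell).
Local Notation res := (restr_iS ell).
Local Notation d := (cop_density p R).
Local Notation gam := (gammaS R ell).
Implicit Types (x y : Sigma m).

(** Membership of the first k letters of y in Pref_k(Omega). *)
Definition pref k y : bool := `[< exists z, Omega z /\ agree k z y >].

Lemma pref_local k : local k (pref k).
Proof.
move=> x y xy; apply: asbool_equiv_eq; split=> -[z [Oz zx]]; exists z; split => //.
  exact: agree_trans zx xy.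
exact: agree_trans zx (agree_sym xy).
Qed.

Lemma pref_le k k' y : (k <= k')%N -> pref k' y -> pref k y.
Proof.
by move=> kk' /asboolP[z [Oz zy]]; apply/asboolP; exists z; split => //; apply: agree_le zy.
Qed.

Lemma pref0 y : pref 0 y.
Proof. by apply/asboolP; case: Omega_neq0 => z Oz; exists z. Qed.

Lemma pref_next k y : pref k y -> exists a, pref k.+1 (upd y k a).
Proof.
move=> /asboolP[z [Oz zy]]; exists (z k); apply/asboolP; exists z; split => //.
exact: agreeS_upd.
Qed.

Lemma pref_Omega k y : Omega y -> pref k y.
Proof. by move=> Oy; apply/asboolP; exists y. Qed.

(** The sequence ell, completed by 1 at index 0; with this convention the
    identities below telescope down to the root. *)
Definition lam k : R := if k is 0 then 1 else (ell k)%:R.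

Lemma lam_gt0 k : 0 < lam k.
Proof. by case: k => //= k; rewrite ltr0n (ell_gt0 G). Qed.

(** Backward recursion for lam k times the largest weighted entropy that can be
    produced below a prefix, with r levels remaining. If the levels below ya can
    still produce tau(ya) / lam_(k+1), then choosing the next letter with
    probabilities proportional to exp(tau(ya)) is optimal by Gibbs' inequality,
    and produces ln (sum of the exp(tau(ya))) / lam_(k+1) = tau(y) / lam_k. *)
Fixpoint tauR r k y : R :=
  if r is r'.+1 then
    lam k / lam k.+1 *
      ln (\sum_(a : letter m | pref k.+1 (upd y k a)) expR (tauR r' k.+1 (upd y k a)))
  else 0.

Definition tau k y : R := tauR (K - k) k y.

Lemma tauR_local r k : local k (tauR r k).
Proof.
elim: r k => [|r IH] k x y xy //=; congr (_ * ln _).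
apply: eq_big => a; first by rewrite (pref_local (agree_updS a xy)).
by move=> _; rewrite (IH _ _ _ (agree_updS a xy)).
Qed.

Lemma tau_local k : local k (tau k).
Proof. exact: tauR_local. Qed.

Lemma sum_next_ge1 (g : letter m -> R) k y : pref k y ->
  (forall a, 0 <= g a) -> 1 <= \sum_(a : letter m | pref k.+1 (upd y k a)) expR (g a).
Proof.
move=> /pref_next[a ha] g0; rewrite (bigD1 a) //=.
apply: (@le_trans _ _ (expR (g a))); first by rewrite -[leLHS]expR0 ler_expR.
by rewrite lerDl sumr_ge0 // => b _; rewrite expR_ge0.
Qed.

Lemma tauR_ge0 r k y : 0 <= tauR r k y.
Proof.
elim: r k y => [|r IH] k y //=; rewrite mulr_ge0 ?divr_ge0 ?(ltW (lam_gt0 _)) //.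
have [pk|npk] := boolP (pref k y); first by rewrite ln_ge0 // sum_next_ge1.
rewrite big_pred0 ?ln0 // => a; apply/negP => /(pref_le (leqnSn k)).
by rewrite (pref_local (agree_upd y a)); apply/negP.
Qed.

Lemma tau_ge0 k y : 0 <= tau k y.
Proof. exact: tauR_ge0. Qed.

Lemma tauK y : tau K y = 0.
Proof. by rewrite /tau subnn. Qed.

Lemma tau_rec k y : (k < K)%N -> tau k y = lam k / lam k.+1 *
  ln (\sum_(a : letter m | pref k.+1 (upd y k a)) expR (tau k.+1 (upd y k a))).
Proof. by move=> kK; rewrite /tau -[(K - k)%N]prednK ?subn_gt0 // -subnS. Qed.

(** The logarithm of the optimal conditional probability of the letter at index k. *)
Definition log_cond k y : R := tau k.+1 y - lam k.+1 / lam k * tau k y.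

Lemma sum_log_cond k y : (k < K)%N -> pref k y ->
  \sum_(a : letter m | pref k.+1 (upd y k a)) expR (log_cond k (upd y k a)) = 1.
Proof.
move=> kK pk; pose S :=
  \sum_(a : letter m | pref k.+1 (upd y k a)) expR (tau k.+1 (upd y k a)).
have S1 : 1 <= S by apply: (sum_next_ge1 pk) => a; exact: tau_ge0.
have S0 : 0 < S by apply: lt_le_trans S1.
transitivity (\sum_(a : letter m | pref k.+1 (upd y k a)) expR (tau k.+1 (upd y k a)) / S).
  apply: eq_bigr => a _; rewrite /log_cond expRD; congr (_ * _).
  rewrite (tau_local (agree_upd y a)) tau_rec // -/S mulrA.
  have := lam_gt0 k; have := lam_gt0 k.+1 => l1 l0.
  by rewrite mulrA divfK ?gt_eqF // divff ?gt_eqF // mul1r expRN lnK.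
by rewrite -mulr_suml divff // gt_eqF.
Qed.

(** Beyond level K the letters are chosen uniformly in the whole alphabet: this
    may leave Omega, but the upper bound only needs a bound for the mass from
    below on X. *)
Fixpoint opt_mass k y : R :=
  if k is k'.+1 then
    opt_mass k' y * (if (k' < K)%N then (if pref k'.+1 y then expR (log_cond k' y) else 0) else m%:R^-1)
  else 1.

Lemma opt_mass_pref k y : (k <= K)%N -> opt_mass k y != 0 -> pref k y.
Proof.
case: k => [|k] kK /=; first by rewrite pref0.
by rewrite kK; case: ifP => //; rewrite mulr0 eqxx.
Qed.

Lemma log_cond_local k : local k.+1 (log_cond k).
Proof.
move=> x y xy; rewrite /log_cond (tau_local xy).
by rewrite (tau_local (agree_le (leqnSn k) xy)).
Qed.

Lemma opt_mass_local k : local k (opt_mass k).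
Proof.
elim: k => [|k IH] x y xy //=.
by rewrite (IH _ _ (agree_le (leqnSn k) xy)) (pref_local xy) (log_cond_local xy).
Qed.

Lemma opt_mass_ge0 k y : 0 <= opt_mass k y.
Proof.
elim: k => [|k IH] //=; rewrite mulr_ge0 //; case: ifP => _; last by rewrite invr_ge0.
by case: ifP => // _; rewrite expR_ge0.
Qed.

Lemma opt_mass_consistent : consistent opt_mass.
Proof.
split=> [||//|k y]; [exact: opt_mass_local|exact: opt_mass_ge0|] => /=.
under eq_bigr => a _ do rewrite (opt_mass_local (agree_upd y a)).
rewrite -mulr_sumr; have [kK|_] := ltnP k K; last first.
  by rewrite sumr_const card_ord prednK 1?ltnW // -[X in _ * X]mulr_natr mulVf ?mulr1 // pnatr_eq0; lia.
have [->|qk] := eqVneq (opt_mass k y) 0; first by rewrite mul0r.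
by rewrite -big_mkcond /= sum_log_cond ?mulr1 // opt_mass_pref // ltnW.
Qed.

Lemma opt_mass_gt0 k y : pref (minn k K) y -> 0 < opt_mass k y.
Proof.
elim: k => [|k IH] //= pk; rewrite mulr_gt0 ?IH //.
  by apply: pref_le pk; rewrite leq_min !geq_min leqnSn leqnn ?orbT.
case: ltnP => kK; last by rewrite invr_gt0 m_gt0.
by move: pk; rewrite (minn_idPl kK) => ->; rewrite expR_gt0.
Qed.

Lemma ln_opt_mass k y : pref (minn k K) y ->
  ln (opt_mass k y) = \sum_(j < minn k K) log_cond j y - (k - minn k K)%:R * ln m%:R.
Proof.
elim: k => [|k IH] pk; first by rewrite min0n big_ord0 ln1 mul0r subr0.
have pk' : pref (minn k K) y.
  by apply: pref_le pk; rewrite leq_min !geq_min leqnSn leqnn ?orbT.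
have qk : 0 < opt_mass k y by exact: opt_mass_gt0.
have := IH pk' => {}IH; rewrite /=; case: ltnP => kK.
  move: pk; rewrite (minn_idPl kK) => pk; rewrite pk lnM ?posrE ?expR_gt0 // expRK IH.
  by rewrite (minn_idPl (ltnW kK)) !subnn !mul0r !subr0 big_ord_recr.
rewrite lnM ?posrE ?invr_gt0 ?m_gt0 // IH lnV ?posrE ?m_gt0 //.
rewrite (minn_idPr kK) (minn_idPr (leqW kK)) subSn // -natr1; ring.
Qed.

Definition tau0 : R := tau 0 (fun=> ord0).

Lemma tau0E y : tau 0 y = tau0.
Proof. exact: tau_local. Qed.

Lemma tau0_ge0 : 0 <= tau0. Proof. exact: tau_ge0. Qed.

(** The weighted sum of the logarithms of the masses is constant on the tree: by
    [abel] it is the sum over k of log_cond k / lam_(k+1), which telescopes. *)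
Lemma level_entropy_opt_mass : (0 < K)%N ->
  \sum_(1 <= k < K) level_entropy opt_mass k * wt R ell k +
    level_entropy opt_mass K / (ell K)%:R = tau0.
Proof.
move=> K0; have cq := opt_mass_consistent.
have HK k : (k <= K)%N ->
  level_entropy opt_mass k = - wsum K (fun y => opt_mass K y * ln (opt_mass k y)).
  move=> kK; rewrite /level_entropy (consistent_wsum cq (h := fun y => ln (opt_mass k y)) _ kK) //.
  by move=> x y xy; rewrite (opt_mass_local xy).
pose F y := \sum_(1 <= k < K) ln (opt_mass k y) * wt R ell k + ln (opt_mass K y) / (ell K)%:R.
transitivity (- wsum K (fun y => opt_mass K y * F y)).
  rewrite HK // /F; under [in RHS]eq_wsum do rewrite mulrDr mulr_sumr.
  rewrite wsumD wsum_sum opprD; congr (_ + _).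
    rewrite -sumrN !big_nat; apply: eq_bigr => k /andP[_ kK].
    rewrite HK ?(ltnW kK) // mulNr -wsumZr; congr (- _).
    by apply: eq_wsum => y; rewrite mulrA.
  by rewrite mulNr -wsumZr; congr (- _); apply: eq_wsum => y; rewrite mulrA.
rewrite (@eq_wsum _ _ _ _ (fun y => opt_mass K y * - tau0)); last first.
  move=> y; have [->|qK] := eqVneq (opt_mass K y) 0; first by rewrite !mul0r.
  congr (_ * _); have pK := opt_mass_pref (leqnn K) qK.
  rewrite /F -(abel _ (a := fun k => ln (opt_mass k y))) ?ln1 //.
  rewrite (eq_bigr (fun k : 'I_K => tau k.+1 y / lam k.+1 - tau k y / lam k)); last first.
    move=> k _; have kK := ltn_ord k; rewrite !ln_opt_mass ?(minn_idPl _) ?(ltnW kK) //;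
      last 2 first.
    - by apply: pref_le pK; exact: ltnW.
    - by apply: pref_le pK.
    rewrite big_ord_recr /= !subnn !mul0r !subr0 addrAC subrr add0r /log_cond mulrBl;
      congr (_ - _).
    have := lam_gt0 k; have := lam_gt0 k.+1 => /= l1 l0.
    by rewrite mulrAC [_ / lam k / _]mulrAC divff ?gt_eqF // mul1r mulrC.
  rewrite -(big_mkord xpredT (fun k => tau k.+1 y / lam k.+1 - tau k y / lam k)).
  by rewrite (telescope_sumr (fun k => tau k y / lam k)) // tauK mul0r sub0r /= divr1 tau0E.
by rewrite wsumZr consistent_wsum1 // mul1r opprK.
Qed.

Definition lamn k : nat := if k is 0 then 1%N else ell k.

Lemma lamE k : lam k = (lamn k)%:R.
Proof. by case: k. Qed.

Lemma lamn_gt0 k : (0 < lamn k)%N.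
Proof. by rewrite -(ltr0n R) -lamE lam_gt0. Qed.

Lemma lamn_le k : (lamn k <= lamn k.+1)%N.
Proof.
case: k => [|k] /=; first by rewrite (ell1 G).
by rewrite (ell_leE G).
Qed.

Lemma log_weight_swap (b : nat -> R) i T : (0 < i)%N ->
  \sum_(1 <= n < T) log_weight R n * (\sum_(j < minn (fibre_len n i) K) b j) =
  \sum_(j < K) b j * log_weight_tail R T (i * L j).
Proof.
move=> i0; under eq_bigr => n _.
  rewrite -(big_mkord xpredT b) (big_nat_widen _ _ _ _ _ (geq_minr _ _)) /=.
  rewrite big_mkord mulr_sumr.
  rewrite (eq_bigl (fun k : 'I_K => (i * L k <= n)%N)); last first.
    by move=> k /=; rewrite ltn_min ltn_ord andbT (ltn_fibre_len G).
  over.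
rewrite (exchange_big_dep xpredT) //=; apply: eq_bigr => j _.
by rewrite /log_weight_tail mulr_sumr; apply: eq_bigr => n _; rewrite mulrC.
Qed.

(** Exchanging the sums, log_cond j is weighted by a tail of the weights starting
    at the position i lam_(j+1). As r times the tail at r decreases, the terms
    with tau j are dominated by those of the previous index, and the sum
    telescopes to the root. *)
Lemma log_cond_avg i y T : (0 < i)%N ->
  - (tau0 * log_weight_tail R T i) <=
  \sum_(1 <= n < T) log_weight R n * (\sum_(j < minn (fibre_len n i) K) log_cond j y).
Proof.
move=> i0; rewrite (log_weight_swap (fun j => log_cond j y)) //.
pose W j := log_weight_tail R T (i * lamn j).
apply: (@le_trans _ _ (\sum_(j < K) (tau j.+1 y * W j.+1 - tau j y * W j))).
  rewrite -(big_mkord xpredT (fun j => tau j.+1 y * W j.+1 - tau j y * W j)).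
  by rewrite (telescope_sumr (fun j => tau j y * W j)) // tauK mul0r sub0r tau0E /W muln1.
apply: ler_sum => j _;
  rewrite -[log_weight_tail _ _ (i * L j)]/(W j.+1) /log_cond mulrBl lerD2l lerN2.
rewrite mulrAC mulrC ler_wpM2l ?tau_ge0 // mulrAC ler_pdivrMr ?lam_gt0 // [leRHS]mulrC.
have h : (i * lamn j <= i * lamn j.+1)%N by rewrite leq_pmul2l // lamn_le.
have ij : (0 < i * lamn j)%N by rewrite muln_gt0 i0 lamn_gt0.
have := @log_weight_tail_mono R T _ _ ij h; rewrite !natrM -!lamE -!mulrA.
by rewrite ler_pM2l // ltr0n.
Qed.

Lemma sum_cop_widen (F : nat -> R) n T : (n < T)%N ->
  (forall i, cop i -> (n < i)%N -> F i = 0) ->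
  \sum_(i < n.+1 | cop i) F i = \sum_(i < T | cop i) F i.
Proof.
move=> nT F0; rewrite -(big_mkord cop F) -(big_mkord cop F).
rewrite [RHS](big_cat_nat (n := n.+1)) //= [X in _ + X]big_nat_cond [X in _ + X]big1 ?addr0 //.
by move=> i /andP[/andP[ni _] ci]; exact: F0.
Qed.

(** The part of the logarithm of the mass of a point of X that comes from the first
    K levels of its fibres. *)
Definition Phi n x : R :=
  \sum_(i < n.+1 | cop i) \sum_(j < minn (fibre_len n i) K) log_cond j (res x i).

Lemma Phi_avg x T : 0 <= \sum_(1 <= n < T) log_weight R n * (Phi n x + tau0 * (cop_count p n)%:R).
Proof.
pose F n i := \sum_(j < minn (fibre_len n i) K) log_cond j (res x i) + tau0 * (i <= n)%N%:R.
have FE n : (n < T)%N -> Phi n x + tau0 * (cop_count p n)%:R = \sum_(i < T | cop i) F n i.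
  move=> nT; rewrite -(@sum_cop_widen (F n) n) //; last first.
    move=> i ci ni; rewrite /F (fibre_len0 G) ?(cop_gt0 G) // min0n big_ord0 add0r.
    by rewrite leqNgt ni mulr0.
  rewrite big_split /=; congr (_ + _); rewrite -mulr_sumr natr_sum; congr (_ * _).
  by apply: eq_bigr => i _; rewrite -ltnS ltn_ord.
rewrite big_nat (eq_bigr (fun n => \sum_(i < T | cop i) log_weight R n * F n i)); last first.
  by move=> n /andP[_ nT]; rewrite FE // mulr_sumr.
rewrite -big_nat exchange_big /=; apply: sumr_ge0 => i ci.
have i0 := cop_gt0 G ci.
rewrite (eq_bigr (fun n => log_weight R n * (\sum_(j < minn (fibre_len n i) K) log_cond j (res x i))
   + tau0 * (if (i <= n)%N then log_weight R n else 0))); last first.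
  by move=> n _; rewrite mulrDr; congr (_ + _); case: ifP => _; rewrite ?mulr1 ?mulr0 1?mulrC.
rewrite big_split /= -mulr_sumr -big_mkcond /=.
by have := log_cond_avg (res x i) T i0; rewrite -subr_ge0 opprK.
Qed.

(** Otherwise the mass of x|n would be below exp(- n sigma) for all large n, and
    [Phi_avg] would contradict the divergence of the harmonic series. The
    levels beyond K cost ln m per position, and there are at most
    n (gamma - inv_sum K) such positions. *)
Lemma fibre_mass_lower x (sigma : R) N0 :
  d * tau0 + ln m%:R * (gam - inv_sum ell R K) < sigma -> X_set p ell Omega x ->
  exists2 n, (N0 <= n)%N & expR (- (n%:R * sigma)) <= fibre_mass p ell opt_mass n x.
Proof.
move=> hs Xx; apply: contrapT => nex.
have lm0 := lnm_gt0 R m_ge2.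
have Px n : 0 < fibre_mass p ell opt_mass n x /\
   ln (fibre_mass p ell opt_mass n x) >= Phi n x - ln m%:R * (n%:R * (gam - inv_sum ell R K)).
  have pr i : cop i -> pref (minn (fibre_len n i) K) (res x i).
    by move=> ci; apply: pref_Omega; apply: Xx; [exact: (cop_gt0 G)|apply/copP].
  have qi i : cop i -> 0 < opt_mass (fibre_len n i) (res x i) by move=> ci;
    apply/opt_mass_gt0/pr.
  split; first by apply: prodr_gt0 => i; exact: qi.
  have -> : ln (fibre_mass p ell opt_mass n x) = \sum_(i < n.+1 | cop i)
    ln (opt_mass (fibre_len n i) (res x i)).
    rewrite /fibre_mass.
    have [] // : 0 < \prod_(i < n.+1 | cop i) opt_mass (fibre_len n i) (res x i) /\
       ln (\prod_(i < n.+1 | cop i) opt_mass (fibre_len n i) (res x i)) =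
       \sum_(i < n.+1 | cop i) ln (opt_mass (fibre_len n i) (res x i)).
    apply: (big_rec2 (fun u v => 0 < u /\ ln u = v)) => [|i u v ci [u0 <-]].
      by rewrite ln1.
    by rewrite mulr_gt0 ?qi // lnM ?posrE ?qi.
  rewrite (eq_bigr (fun i : 'I_n.+1 => \sum_(j < minn (fibre_len n i) K) log_cond j (res x i)
      - (fibre_len n i - minn (fibre_len n i) K)%:R * ln m%:R)); last by move=> i ci;
        rewrite ln_opt_mass ?pr.
  rewrite sumrB lerD2l lerN2 -mulr_suml mulrC ler_pM2l //.
  apply: le_trans (tail_count G R n K).
  rewrite -[X in X%:R - _](sum_fibre_len G (ltnSn n)) natr_sum -sumrB.
  by apply: ler_sum => i _; rewrite natrB ?geq_minl // sumr_const card_ord.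
pose g := sigma - (d * tau0 + ln m%:R * (gam - inv_sum ell R K)).
have g0 : 0 < g by rewrite subr_gt0.
pose B := tau0 * (modulus p)%:R.
have B0 : 0 <= B by rewrite mulr_ge0 // tau0_ge0.
pose N1 := (maxn N0 (Num.bound (B / (g / 2)))).+1.
have g20 : 0 < g / 2 by rewrite divr_gt0.
apply: (@log_average R (fun n => Phi n x + tau0 * (cop_count p n)%:R) (g / 2) N1) => //;
  last first.
  exact: Phi_avg.
move=> n Nn.
have [P0 hP] := Px n.
have h1 : ln (fibre_mass p ell opt_mass n x) < - (n%:R * sigma).
  rewrite ltNge; apply/negP => h; apply: nex; exists n.
    by apply: leq_trans Nn; rewrite leqW // leq_maxl.
  by rewrite -[leRHS]lnK ?posrE // ler_expR.
have h2 : tau0 * (cop_count p n)%:R <= tau0 * (n%:R * d) + B.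
  rewrite /B -mulrDr ler_wpM2l ?tau0_ge0 //.
  have := cop_count_density G R n; rewrite ler_norml => /andP[_]; lra.
have h3 : B <= (g / 2) * n%:R.
  rewrite mulrC -ler_pdivrMr //; apply: ltW;
    apply: (@lt_le_trans _ _ (Num.bound (B / (g / 2)))%:R).
    by apply: archi_boundP; rewrite divr_ge0 // ltW.
  by rewrite ler_nat; apply: leq_trans Nn; rewrite leqW // leq_maxr.
have e : n%:R * sigma = n%:R * g + (n%:R * d * tau0 + ln m%:R * (n%:R * (gam - inv_sum ell R K))).
  by rewrite /g; ring.
have e2 : n%:R * g = (g / 2) * n%:R + (g / 2) * n%:R by field.
lra.
Qed.

Lemma hausdorff_eq0_tau0 (s : R) : 0 < s ->
  d * tau0 + ln m%:R * (gam - inv_sum ell R K) < s * ln m%:R ->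
  hausdorff_measure s (X_set p ell Omega) = 0%E.
Proof.
move=> s0 hs.
set A := _ + _ in hs; pose sigma := (A + s * ln m%:R) / 2.
have h1 : A < sigma by rewrite /sigma; lra.
have h2 : sigma < s * ln m%:R by rewrite /sigma; lra.
have cP := fibre_mass_consistent G opt_mass_consistent.
apply: (hausdorff_eq0 (P := fibre_mass p ell opt_mass) m_ge2 s0 h2); try by case: cP.
  by move=> n; rewrite consistent_wsum1.
by move=> x N0 Xx; apply: fibre_mass_lower.
Qed.

End Optimal.

(** * Entropies of measures on Omega *)

Section Gibbs.
Context (R : realType).

Lemma ln_le_sub1 (z : R) : 0 < z -> ln z <= z - 1.
Proof. by move=> z0; have := expR_ge1Dx (ln z); rewrite lnK ?posrE //; lra. Qed.

(** Jensen's inequality for the logarithm, in the form ln z <= z - 1. The weights g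
    may vanish where q does. *)
Lemma gibbs (I : finType) (P : pred I) (q g : I -> R) :
  (forall i, P i -> 0 <= q i) -> \sum_(i | P i) q i = 1 ->
  (forall i, P i -> 0 <= g i) -> (forall i, P i -> q i != 0 -> 0 < g i) ->
  - \sum_(i | P i) q i * ln (q i) + \sum_(i | P i) q i * ln (g i) <= ln (\sum_(i | P i) g i).
Proof.
move=> q0 q1 g0 qg; set S := \sum_(i | P i) g i.
have S0 : 0 < S.
  have [i /andP[Pi qi]|P0] := pickP (fun i => P i && (q i != 0)).
    rewrite /S (bigD1 i) //= ltr_wpDr ?qg // sumr_ge0 // => j /andP[Pj _]; exact: g0.
  move: q1; rewrite big1 => [/eqP|i Pi]; first by rewrite eq_sym oner_eq0.
  by apply/eqP; have := P0 i; rewrite Pi /= => /negbFE.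
rewrite -subr_le0 -[ln S]mul1r -q1 mulr_suml -sumrN -big_split -sumrB /=.
apply: (@le_trans _ _ (\sum_(i | P i) (g i / S - q i))); last first.
  by rewrite sumrB -mulr_suml q1 divff ?subrr // gt_eqF.
apply: ler_sum => i Pi; have := q0 i Pi; rewrite le_eqVlt => /orP[/eqP <-|qi].
  by rewrite !mul0r oppr0 !addr0 divr_ge0 ?g0 // ltW.
have gi : 0 < g i by apply: qg => //; rewrite gt_eqF.
have h : 0 < g i / (S * q i) by rewrite divr_gt0 // mulr_gt0.
have := ln_le_sub1 h; rewrite lnM ?posrE ?invr_gt0 ?mulr_gt0 // lnV ?posrE ?mulr_gt0 //.
rewrite lnM ?posrE // => /(ler_wpM2l (ltW qi)).
have -> : q i * (g i / (S * q i) - 1) = g i / S - q i by field; rewrite !gt_eqF.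
by apply: le_trans; rewrite le_eqVlt; apply/orP; left; apply/eqP; ring.
Qed.

End Gibbs.

Section Weighted.
Context (J : nat) (p : 'I_J -> nat) (ell : nat -> nat).
Context (G : generated p ell) (R : realType).
Local Notation gam := (gammaS R ell).

Lemma wt_gt0 k : (0 < k)%N -> 0 < wt R ell k.
Proof.
case: k => // k _; rewrite /wt subr_gt0 ltf_pV2 ?posrE ?ltr0n ?(ell_gt0 G) //.
by rewrite ltr_nat (ell_incr G).
Qed.

Definition wpart (a : nat -> R) n : R := \sum_(1 <= k < n) a k * wt R ell k.

Definition wlim (a : nat -> R) : R := limn (wpart a).

(** Linear growth makes the weighted series converge, being dominated by the series
    of the 1/ell_k. *)
Definition lingrowth (a : nat -> R) : Prop :=
  exists A, 0 <= A /\ forall k, (0 < k)%N -> 0 <= a k <= k%:R * A.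

Lemma wpart_le (a b : nat -> R) n : (forall k, (0 < k)%N -> a k <= b k) ->
  wpart a n <= wpart b n.
Proof.
move=> ab; rewrite /wpart !big_nat; apply: ler_sum => k /andP[k0 _].
by rewrite ler_wpM2r ?ab // ltW // wt_gt0.
Qed.

Lemma wpart_id n : (0 < n)%N -> wpart (fun k => k%:R) n + n%:R / (ell n)%:R = inv_sum ell R n.
Proof.
move=> n0; rewrite /wpart -(abel _ (a := fun k => k%:R)) //; apply: eq_bigr => k _.
by rewrite -natr1 addrAC subrr add0r mul1r.
Qed.

Lemma wpart_mono a : lingrowth a -> {homo wpart a : i j / (i <= j)%N >-> i <= j}.
Proof.
move=> [A [A0 ha]]; apply: homo_leq => [x|y x z|n]; [exact: lexx | exact: le_trans |].
case: n => [|n]; first by rewrite /wpart !big_geq.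
rewrite /wpart [leRHS]big_nat_recr //= lerDl mulr_ge0 //;
  first by case/andP: (ha n.+1 (ltn0Sn n)).
by rewrite ltW // wt_gt0.
Qed.

Lemma wpart_cvg a : lingrowth a -> cvgn (wpart a).
Proof.
move=> lg; have [A [A0 ha]] := lg; apply: nondecreasing_is_cvgn; first exact: wpart_mono.
exists (gam * A) => _ [n _ <-]; case: n => [|n].
  by rewrite /wpart big_geq // mulr_ge0 // ltW // (gamma_gt0 G).
apply: (@le_trans _ _ (wpart (fun k => k%:R * A) n.+1)).
  by apply: wpart_le => k k0; case/andP: (ha k k0).
have -> : wpart (fun k => k%:R * A) n.+1 = wpart (fun k => k%:R) n.+1 * A.
  by rewrite /wpart mulr_suml; apply: eq_bigr => k _; rewrite mulrAC.
rewrite ler_wpM2r //; apply: le_trans (inv_sum_le G R n.+1).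
by rewrite -wpart_id // lerDl divr_ge0.
Qed.

Lemma wpart_wlim a n : lingrowth a -> wpart a n <= wlim a.
Proof.
by move=> lg; apply: nondecreasing_cvgn_le; [exact: wpart_mono|exact: wpart_cvg].
Qed.

Lemma wlim_cvg a : lingrowth a -> wpart a @ \oo --> wlim a.
Proof. exact: wpart_cvg. Qed.

Lemma wlim_le a b : lingrowth a -> lingrowth b -> (forall k, (0 < k)%N -> a k <= b k) ->
  wlim a <= wlim b.
Proof.
move=> la lb ab; apply: ler_lim; [exact: wpart_cvg|exact: wpart_cvg|].
by apply: nearW => n; exact: wpart_le.
Qed.

Lemma wlim_lt_ex a c : lingrowth a -> c < wlim a -> exists n, c < wpart a n.
Proof.
move=> la cw; apply: contrapT => nex.
have : wlim a <= c.
  apply: limr_le; first exact: wpart_cvg.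
  by apply: nearW => n; rewrite leNgt; apply/negP => h; apply: nex; exists n.
by rewrite leNgt cw.
Qed.

End Weighted.

Section Measures.
Context (R : realType) (m : nat) (m_ge2 : (2 <= m)%N).
Context (Omega : set (Sigma m)) (Omega_closed : closed Omega).
Implicit Types (x y : Sigma m).

Lemma borel_open (A : set (Sigma m)) : open A -> measurable (A : set (borel m)).
Proof. by move=> oA; apply: sub_sigma_algebra. Qed.

Lemma borel_closed (A : set (Sigma m)) : closed A -> measurable (A : set (borel m)).
Proof.
move=> cA; rewrite -[A]setCK; apply: measurableC; apply: borel_open.
exact: closed_openC.
Qed.

Lemma borel_agree k y : measurable (Omega `&` [set x | agree k x y] : set (borel m)).
Proof.
by apply: measurableI; [exact: borel_closed|apply: borel_open; exact: open_agree].
Qed.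

Section OfMeasure.
Context (mu : probability (borel m) R) (mu1 : mu Omega = 1%E).

Definition cyl_mass k y : R := fine (mu (Omega `&` [set x | agree k x y])).

Lemma prob_fin_num (A : set (borel m)) : measurable A -> mu A \is a fin_num.
Proof. by move=> mA; apply: fin_num_measure. Qed.

Lemma cyl_massE k y : (cyl_mass k y)%:E = mu (Omega `&` [set x | agree k x y]).
Proof. by rewrite /cyl_mass fineK // prob_fin_num //; exact: borel_agree. Qed.

Lemma cyl_mass_consistent : consistent cyl_mass.
Proof.
split.
- move=> k x y xy; rewrite /cyl_mass; congr (fine (mu (_ `&` _))); apply/seteqP;
  split => z /= h.
    exact: agree_trans h xy.
  exact: agree_trans h (agree_sym xy).
- by move=> k y; rewrite /cyl_mass fine_ge0.
- move=> y; rewrite /cyl_mass (_ : [set x | agree 0 x y] = setT) ?setIT ?mu1 //.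
  by apply/seteqP; split.
move=> k y; apply: EFin_inj; rewrite -sumEFin.
under eq_bigr do rewrite cyl_massE.
rewrite cyl_massE; have -> : Omega `&` [set x | agree k x y] =
    \big[setU/set0]_(a : letter m) (Omega `&` [set x | agree k.+1 x (upd y k a)]).
  rewrite -bigcup_seq; apply/seteqP; split => [x [Ox xy]|x [a _ [Ox xa]]].
    exists (x k); first by rewrite /= mem_index_enum.
    by split => //; exact: agreeS_upd.
  split => //=; apply: agree_trans (agree_le (leqnSn k) xa) _; exact: agree_upd.
symmetry; apply: (@measure_bigsetU_ord _ _ _ mu) => [a|]; first exact: borel_agree.
move=> a b _ _ [x [[_ xa] [_ xb]]].
by have := xa k (ltnSn k); rewrite (xb k (ltnSn k)) !updE.
Qed.

(** All cylinders around y meet Omega, which is closed. *)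
Lemma cyl_mass_support y : (forall k, 0 < cyl_mass k y) -> Omega y.
Proof.
move=> h; apply: (closed_agree Omega_closed) => k; apply: contrapT => ne.
have := h k; rewrite /cyl_mass (_ : _ `&` _ = set0) ?measure0 ?ltxx //.
by apply/seteqP; split => // x [Ox xy]; apply: ne; exists x.
Qed.

Lemma cylinder_agree k (u : k.-tuple (letter m)) : cylinder u = [set x | agree k x (ext u)].
Proof. by apply/seteqP; split => x /cylinderP. Qed.

Lemma PrefP k (u : k.-tuple (letter m)) : Pref Omega u <-> pref Omega k (ext u).
Proof.
rewrite /Pref /pref /= cylinder_agree; split => [[z [Oz zu]]|/asboolP[z [Oz zu]]].
  by apply/asboolP; exists z.
by exists z.
Qed.

(** The nonempty traces of distinct cylinders are distinct, and the empty ones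
    contribute 0 ln 0 = 0. *)
Lemma entropyE k : entropy mu (cylinder_partition Omega k) = level_entropy cyl_mass k / ln m%:R.
Proof.
rewrite /entropy /cylinder_partition fsbig_image; last first.
  move=> u v /set_mem Pu _ e; case: (Pu) => z hz; have : (Omega `&` cylinder u) z by [].
  rewrite [in X in X -> _]e; move: hz => [_ /cylinderP zu] [_ /cylinderP zv].
  rewrite -(trunc_ext u) -(trunc_ext v); apply/trunc_agree.
  exact: agree_trans (agree_sym zu) zv.
pose r := [seq u <- index_enum (k.-tuple (letter m) : finType) | `[< Pref Omega u >]].
rewrite (_ : @Pref m Omega k = [set` r]); last first.
  apply/seteqP; split => u; rewrite /= mem_filter mem_index_enum andbT => /asboolP //.
rewrite -fsbig_seq; last by rewrite filter_uniq // index_enum_uniq.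
rewrite /r big_filter /level_entropy /wsum mulNr; congr (- _);
  rewrite mulr_suml [LHS]big_mkcond /=.
apply: eq_bigr => u _.
have -> : fine (mu (Omega `&` cylinder u)) = cyl_mass k (ext u).
  by rewrite /cyl_mass -cylinder_agree.
case: asboolP => [_|nP]; first by rewrite mulrA.
have -> : cyl_mass k (ext u) = 0; last by rewrite !mul0r.
rewrite /cyl_mass -cylinder_agree (_ : _ `&` _ = set0) ?measure0 //.
by apply/seteqP; split => // x hx; apply: nP; exists x.
Qed.

End OfMeasure.
End Measures.

Section Atomic.
Context (R : realType) (m : nat).

(** The normalization of a measure is a probability, and total mass 1 makes it
    equal to the measure. *)
Lemma prob_of_measure (d : measure_display) (T : measurableType d)
  (nu : {measure set T -> \bar R}) : nu setT = 1%E ->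
  exists mu : probability T R, forall A, mu A = nu A.
Proof.
move=> nu1; pose P : probability T R := mnormalize nu (dirac (point : T)).
exists P => A; rewrite /P /= /mnormalize nu1 /=.
by rewrite onee_eq0 /= invr1 mule1.
Qed.

Lemma finite_atomic_prob (I : finType) (i0 : I) (w : I -> R) (z : I -> borel m) :
  (forall i, 0 <= w i) -> \sum_i w i = 1 ->
  exists mu : probability (borel m) R, forall A : set (borel m), measurable A ->
    mu A = (\sum_i w i * \1_A (z i))%:E.
Proof.
move=> w0 w1.
pose e k := nth i0 (enum I) k.
pose mm (k : nat) := mscale (NngNum (w0 (e k))) (@dirac _ (borel m) (z (e k)) R).
pose nu := msum mm #|I|.
have nuE A : measurable A -> nu A = (\sum_i w i * \1_A (z i))%:E.
  move=> mA; rewrite /nu /msum -sumEFin -[RHS]big_enum /= (big_nth i0) big_mkord -cardE.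
  by apply: eq_bigr => k _; rewrite /mm /mscale /= diracE EFinM indicE.
have nu1 : nu setT = 1%E.
  rewrite nuE //; under eq_bigr do rewrite indicT mulr1.
  by rewrite w1.
have [P hP] := prob_of_measure nu1.
by exists P => A mA; rewrite hP; exact: nuE.
Qed.

Context (m_ge2 : (2 <= m)%N).
Context (Omega : set (Sigma m)) (Omega_closed : closed Omega) (Omega_neq0 : Omega !=set0).

(** A point of Omega is chosen in each K-cylinder of positive mass, and carries
    that mass. *)
Lemma realize (f : nat -> Sigma m -> R) K : consistent f ->
  (forall y, f K y != 0 -> pref Omega K y) ->
  exists mu : probability (borel m) R, mu Omega = 1%E /\
    forall k y, (k <= K)%N -> cyl_mass Omega mu k y = f k y.
Proof.
move=> cf fp; have [lf f0 _ _] := cf.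
have /choice[z hz] (u : K.-tuple (letter m))
  : exists z, Omega z /\ (f K (ext u) != 0 -> agree K z (ext u)).
  have [e|ne] := eqVneq (f K (ext u)) 0; last first.
    by have /asboolP[z [Oz zu]] := fp _ ne; exists z.
  by case: Omega_neq0 => z Oz; exists z.
have [||mu hmu] := @finite_atomic_prob (K.-tuple (letter m) : finType)
  (nseq_tuple K ord0) (fun u => f K (ext u)) z; first by move=> u; exact: f0.
  exact: consistent_wsum1.
exists mu; split.
  rewrite hmu; last exact: borel_closed.
  congr (_%:E); rewrite -[RHS](consistent_wsum1 K cf); apply: eq_bigr => u _.
  by rewrite indicE mem_set ?mulr1 //; case: (hz u).
move=> k y kK; rewrite /cyl_mass hmu /=; last exact: borel_agree.
transitivity (wsum K (fun x => f K x * (`[< agree k x y >])%:R)); last first.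
  by rewrite (consistent_wsum cf (@local_agree R m k y) kK) wsum_point.
apply: eq_bigr => u _; have [->|ne] := eqVneq (f K (ext u)) 0; first by rewrite !mul0r.
congr (_ * _); have [Oz /(_ ne) zu] := hz u; rewrite indicE; congr (nat_of_bool _)%:R.
apply/idP/asboolP => [/set_mem[_ /= zy]|uy].
  exact: agree_trans (agree_sym (agree_le kK zu)) zy.
by apply/mem_set; split => //=; apply: agree_trans (agree_le kK zu) uy.
Qed.

Definition prefix_count k : nat := #|[pred u : k.-tuple (letter m) | pref Omega k (ext u)]|.

Lemma prefix_countE k : (prefix_count k)%:R = wsum k (fun y => (pref Omega k y)%:R) :> R.
Proof.
rewrite /wsum /prefix_count -sum1_card natr_sum big_mkcond /=; apply: eq_bigr => u _.
by rewrite unfold_in /=; case: (pref _ _ _).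
Qed.

Lemma prefix_count_gt0 k : (0 < prefix_count k)%N.
Proof.
case: Omega_neq0 => z Oz; apply/card_gt0P; exists (trunc k z).
by rewrite unfold_in /=; apply/asboolP; exists z; split => //; apply: agree_sym;
  exact: ext_trunc.
Qed.

Definition ln_prefix_count k : R := ln (prefix_count k)%:R.

Lemma ln_prefix_count_ge0 k : 0 <= ln_prefix_count k.
Proof. by rewrite ln_ge0 // ler1n prefix_count_gt0. Qed.

Lemma ln_prefix_count_le k : ln_prefix_count k <= k%:R * ln m%:R.
Proof.
have m0 := m_gt0 R m_ge2; rewrite mulr_natl -lnXn //.
have h : (0 : R) < (prefix_count k)%:R by rewrite ltr0n prefix_count_gt0.
rewrite ler_ln ?posrE ?exprn_gt0 // -natrX ler_nat.
by apply: leq_trans (max_card _) _; rewrite card_tuple card_ord prednK // ltnW.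
Qed.

Lemma lingrowth_prefix_count : lingrowth ln_prefix_count.
Proof.
by exists (ln m%:R); split; [exact/ltW/lnm_gt0|move=> k _;
  rewrite ln_prefix_count_ge0 ln_prefix_count_le].
Qed.

Lemma level_entropy_le (f : nat -> Sigma m -> R) k : consistent f ->
  (forall y, f k y != 0 -> pref Omega k y) -> level_entropy f k <= ln_prefix_count k.
Proof.
move=> cf fp; have [lf f0 _ _] := cf.
have := @gibbs R (k.-tuple (letter m) : finType) (fun u => pref Omega k (ext u))
  (fun u => f k (ext u)) (fun=> 1).
have off (h : Sigma m -> R) : \sum_(u : k.-tuple (letter m) | pref Omega k (ext u)) f k (ext u)
  * h (ext u)
   = wsum k (fun y => f k y * h y).
  rewrite /wsum big_mkcond /=; apply: eq_bigr => u _; case: ifPn => // np.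
  have [->|/fp h1] := eqVneq (f k (ext u)) 0; first by rewrite mul0r.
  by rewrite h1 in np.
move=> /(_ (fun u _ => f0 _ _)) h.
have s1 : \sum_(u : k.-tuple (letter m) | pref Omega k (ext u)) f k (ext u) = 1.
  have := off (fun=> 1); rewrite (@eq_wsum _ _ _ _ (f k)); last by move=> y; rewrite mulr1.
  by rewrite consistent_wsum1 // => <-; apply: eq_bigr => u _; rewrite mulr1.
have := h s1 (fun _ _ => ler01) (fun _ _ _ => ltr01).
rewrite (off (fun y => ln (f k y))) ln1 [X in _ + X]big1 ?addr0; last by move=> u _;
  rewrite mulr0.
rewrite -/(level_entropy f k) => /le_trans; apply.
by rewrite /ln_prefix_count /prefix_count -sum1_card natr_sum.
Qed.

Section OfMeasure.
Context (mu : probability (borel m) R) (mu1 : mu Omega = 1%E).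

Lemma cyl_mass_pref k y : cyl_mass Omega mu k y != 0 -> pref Omega k y.
Proof.
move=> ne; apply: contrapT => np; move/eqP: ne; apply.
rewrite /cyl_mass (_ : _ `&` _ = set0) ?measure0 //.
by apply/seteqP; split => // x [Ox xy]; apply: np; apply/asboolP; exists x.
Qed.

Lemma level_entropy_cyl_mass_le k : level_entropy (cyl_mass Omega mu) k <= ln_prefix_count k.
Proof. by apply: level_entropy_le; [exact: cyl_mass_consistent|exact: cyl_mass_pref]. Qed.

Lemma lingrowth_cyl_mass : lingrowth (level_entropy (cyl_mass Omega mu)).
Proof.
exists (ln m%:R); split; first exact/ltW/lnm_gt0.
move=> k _; rewrite (le_trans (level_entropy_cyl_mass_le k) (ln_prefix_count_le k)) andbT.
by apply: level_entropy_ge0; exact: cyl_mass_consistent.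
Qed.

Context (J : nat) (p : 'I_J -> nat) (ell : nat -> nat).
Context (G : generated p ell).

Lemma s_valueE : s_value ell Omega mu =
  cop_density p R * wlim ell (level_entropy (cyl_mass Omega mu)) / ln m%:R.
Proof.
rewrite /s_value (gammaV G) -mulrA; congr (_ * _).
rewrite (_ : (fun n => _) = (fun n => wpart ell (level_entropy (cyl_mass Omega mu)) n / ln m%:R)).
  apply: cvg_lim => //; apply: cvgMr_tmp; exact: (wlim_cvg G lingrowth_cyl_mass).
apply/funext => n; rewrite /wpart mulr_suml; apply: eq_bigr => k _.
by rewrite entropyE // mulrAC.
Qed.

End OfMeasure.
End Atomic.

(** * Box dimension *)

Section PrefixCount.
Context (J : nat) (p : 'I_J -> nat) (ell : nat -> nat).
Context (G : generated p ell) (R : realType) (m : nat) (m_ge2 : (2 <= m)%N).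
Context (Omega : set (Sigma m)) (Omega_neq0 : Omega !=set0).
Local Notation L k := (ell k.+1).
Local Notation cop := (cop p).
Local Notation fibre_len := (fibre_len ell).
Local Notation res := (restr_iS ell).
Local Notation d := (cop_density p R).
Local Notation gam := (gammaS R ell).
Local Notation X := (X_set p ell Omega).
Implicit Types (x y : Sigma m).

(** Conversely, points of Omega chosen on the fibres are glued into a point of X;
    every position lies on exactly one fibre. *)
Lemma pref_X n x :
  pref X n x = [forall i : 'I_n.+1, cop i ==> pref Omega (fibre_len n i) (res x i)].
Proof.
apply/asboolP/forallP => [[z [Xz zx]] i|h].
  apply/implyP => ci; apply/asboolP; have i0 := cop_gt0 G ci.
  exists (res z i); split; first by apply: Xz => //; apply/copP.
  exact: (restr_agree G).
have /choice[w hw] i : exists w, Omega w /\ (cop i -> agree (fibre_len n i) w (res x i)).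
  have [ci|nci] := boolP (cop i); last by case: Omega_neq0 => w Ow; exists w.
  have [iN|Ni] := ltnP i n.+1; last first.
    by case: Omega_neq0 => w Ow; exists w; split => // _; rewrite (fibre_len0 G) ?(cop_gt0 G).
  have := h (Ordinal iN); rewrite /= ci /= => /asboolP[w [Ow wx]].
  by exists w.
have /choice[ik hik] r : exists ik : nat * nat, cop ik.1 /\ r.+1 = (ik.1 * L ik.2)%N.
  by have [i [k [ci e]]] := decomp_ex G (ltn0Sn r); exists (i, k).
pose z : Sigma m := fun r => w (ik r).1 (ik r).2.
have resz i : cop i -> res z i = w i.
  move=> ci; apply/funext => k; rewrite /restr_iS /at1 /z.
  have := hik (i * L k).-1; rewrite prednK ?muln_gt0 ?(cop_gt0 G ci) ?(ell_gt0 G) //.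
  by case=> c1 /(decomp_inj G ci c1)[<- <-].
exists z; split.
  by move=> i i0 /copP ci; rewrite resz //; case: (hw i).
move=> r rn; rewrite /z; have [ci e] := hik r; have [_ /(_ ci) ->] := hw (ik r).1.
  by rewrite /restr_iS /at1 -e.
by rewrite (ltn_fibre_len G) ?(cop_gt0 G) // -e.
Qed.

Lemma prefix_count_X n : (prefix_count X n)%:R = \prod_(i < n.+1 | cop i)
  (prefix_count Omega (fibre_len n i))%:R :> R.
Proof.
rewrite prefix_countE.
rewrite (@eq_wsum _ _ _ _ (fun x => \prod_(i < n.+1 | cop i) (pref Omega (fibre_len n i) (res x i))%:R)); last first.
  move=> x; rewrite pref_X; case: forallP => [h|nh].
    by rewrite big1 // => i ci; have := h i; rewrite ci => /= ->.
  have [i hi] : exists i : 'I_n.+1, ~~ (cop i ==> pref Omega (fibre_len n i) (res x i)).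
    by apply: contrapT => ne; apply: nh => i; apply/negPn/negP => hi; apply: ne; exists i.
  by move: hi; rewrite negb_imply => /andP[ci /negPf np]; rewrite (bigD1 i) //= np mul0r.
rewrite (wsum_prod G (F := fun i y => (pref Omega (fibre_len n i) y)%:R)) //.
  by apply: eq_bigr => i _; rewrite prefix_countE.
by move=> i _ x y xy; rewrite (pref_local _ xy).
Qed.

Lemma ln_prefix_count_X n : ln_prefix_count R X n = \sum_(i < n.+1 | cop i)
  ln_prefix_count R Omega (fibre_len n i).
Proof.
rewrite /ln_prefix_count prefix_count_X.
have Ng i : 0 < (prefix_count Omega i)%:R :> R by rewrite ltr0n prefix_count_gt0.
have [] // : 0 < \prod_(i < n.+1 | cop i) (prefix_count Omega (fibre_len n i))%:R :> R /\
   ln (\prod_(i < n.+1 | cop i) (prefix_count Omega (fibre_len n i))%:R) =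
   \sum_(i < n.+1 | cop i) ln (prefix_count Omega (fibre_len n i))%:R :> R.
apply: (big_rec2 (fun u v => 0 < u /\ ln u = v)) => [|i u v ci [u0 <-]].
  by rewrite ln1.
by rewrite mulr_gt0 // lnM ?posrE.
Qed.

Lemma X_neq0 : X !=set0.
Proof.
case: Omega_neq0 => w Ow.
have : pref X 0 (fun=> ord0).
  rewrite pref_X; apply/forallP => i; apply/implyP => ci.
  by rewrite (fibre_len0 G) ?(cop_gt0 G) ?pref0 //; case: i ci => -[|[]] //= _ /(cop_gt0 G).
by move=> /asboolP[z [Xz _]]; exists z.
Qed.

(** Fibres with fewer than K positions are handled by [count_asym_wt]. The longer
    ones contribute at most A times the number of positions that they contain,
    and the same count applied to a k = k shows that this is a small fraction
    of n. *)
Lemma fibre_average (a : nat -> R) (A : R) : 0 <= A -> a 0%N = 0 ->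
  (forall k, 0 <= a k <= k%:R * A) ->
  forall e, 0 < e -> exists N, forall n, (N <= n)%N ->
   `| \sum_(i < n.+1 | cop i) a (fibre_len n i) - n%:R * (d * wlim ell a) | <= n%:R * e.
Proof.
move=> A0 a0 ha e e0; have d0 := cop_density_gt0 G R.
have lga : lingrowth a by exists A; split.
have e1 : 0 < e / 3 by rewrite divr_gt0.
have c1 : \forall n \near \oo, wlim ell a - wpart ell a n <= e / 3 / d.
  have := wlim_cvg G lga => /cvgrPdist_le /(_ (e / 3 / d)) /(_ (divr_gt0 e1 d0)).
  apply: filterS => n; apply: le_trans; exact: ler_norm.
have c2 : \forall n \near \oo, A * (1 - d * wpart ell (fun k => k%:R : R) n) <= e / 3.
  have h1 : (fun n => inv_sum ell R n - n%:R / (ell n)%:R) @ \oo --> gam - 0.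
    by apply: cvgB; [exact: (gammaS_cvg G)|exact: (cvg_index_over_ell G)].
  have h2 : (fun n => A * (1 - d * (inv_sum ell R n - n%:R / (ell n)%:R)))
    @ \oo --> A * (1 - d * (gam - 0)).
    by apply: cvgMl_tmp; apply: cvgB; [exact: cvg_cst|exact: cvgMl_tmp].
  move: h2; rewrite subr0 (cop_density_gamma G) subrr mulr0 => /cvgrPdist_le /(_ _ e1).
  apply: filterS2 (nbhs_infty_gt 0) => n n0; rewrite sub0r normrN -(wpart_id ell R n0) addrK.
  by apply: le_trans; exact: ler_norm.
near \oo => K.
have hK1 : wlim ell a - wpart ell a K <= e / 3 / d by near: K.
have hK2 : A * (1 - d * wpart ell (fun k => k%:R : R) K) <= e / 3 by near: K.
(* truncation at K, without boundary term since tr b K = 0 *)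
pose tr (b : nat -> R) k := if (k < K)%N then b k else 0.
have trW b : wpart ell (tr b) K = wpart ell b K.
  by rewrite /wpart !big_nat; apply: eq_bigr => k /andP[_ kK]; rewrite /tr kK.
have trK b : tr b K = 0 by rewrite /tr ltnn.
have trmin b k : tr b (minn k K) = tr b k.
  by have [//|Kk] := leqP k K; rewrite trK /tr ltnNge (ltnW Kk).
have tr0 b : b 0%N = 0 -> tr b 0%N = 0 by move=> b0; rewrite /tr b0; case: ifP.
have [B1 [B10 hB1]] := count_asym_wt G K (tr0 _ a0).
have [B2 [B20 hB2]] := count_asym_wt G K (tr0 (fun k => k%:R) erefl).
pose B := B1 + A * B2.
exists (Num.bound (B / (e / 3))) => n Nn.
have nB : B <= n%:R * (e / 3).
  rewrite -ler_pdivrMr //; apply: ltW; apply: (@lt_le_trans _ _ (Num.bound (B / (e / 3)))%:R).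
    by apply: archi_boundP; rewrite divr_ge0 ?(ltW e1) // addr_ge0 // mulr_ge0.
  by rewrite ler_nat.
have n0 : 0 <= (n%:R : R) by [].
have := hB1 n; rewrite trK mul0r addr0 -/(wpart ell (tr a) K) trW.
have := hB2 n; rewrite trK mul0r addr0 -/(wpart ell (tr _) K) trW.
rewrite (eq_bigr (fun i : 'I_n.+1 => tr (fun k => k%:R) (fibre_len n i)));
  last by move=> i _; rewrite trmin.
rewrite [X in `|X - _| <= B1 -> _](eq_bigr (fun i : 'I_n.+1 => tr a (fibre_len n i)));
  last by move=> i _; rewrite trmin.
set S2 := \sum_(i < n.+1 | cop i) tr _ (fibre_len n i);
  set S1 := \sum_(i < n.+1 | cop i) tr a (fibre_len n i).
rewrite !ler_norml => /andP[h2 h2'] /andP[h1 h1'].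
have lo : S1 <= \sum_(i < n.+1 | cop i) a (fibre_len n i).
  by apply: ler_sum => i _; rewrite /tr; case: ifP => // _; case/andP: (ha (fibre_len n i)).
have up : \sum_(i < n.+1 | cop i) a (fibre_len n i) <= S1 + A * (n%:R - S2).
  rewrite -[X in A * (X%:R - _)](sum_fibre_len G (ltnSn n)) natr_sum -sumrB mulr_sumr -big_split /=.
  apply: ler_sum => i _; rewrite /tr; case: ifP => _.
    by rewrite subrr mulr0 addr0.
  by rewrite add0r subr0 mulrC; case/andP: (ha (fibre_len n i)).
have hV : wpart ell a K <= wlim ell a by exact: (wpart_wlim G K lga).
have k1 : n%:R * (d * (wlim ell a - wpart ell a K)) <= n%:R * (e / 3).
  by rewrite ler_wpM2l // mulrC -ler_pdivlMr.
have k2 : n%:R * (d * wpart ell a K) <= n%:R * (d * wlim ell a).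
  by rewrite ler_wpM2l // ler_wpM2l // ltW.
have k3 : n%:R * (A * (1 - d * wpart ell (fun k => k%:R) K)) <= n%:R * (e / 3).
  by rewrite ler_wpM2l.
have k4 : A * (n%:R - S2) <= A * (n%:R - n%:R * (d * wpart ell (fun k => k%:R) K) + B2).
  by rewrite ler_wpM2l //; lra.
have e3 : n%:R * e = n%:R * (e / 3) + n%:R * (e / 3) + n%:R * (e / 3) by field.
have AB : 0 <= A * B2 by rewrite mulr_ge0.
have ne0 : 0 <= n%:R * (e / 3) by rewrite mulr_ge0 // ltW.
move: nB k1 k3 k4; rewrite /B => nB k1 k3 k4.
by apply/andP; split; lra.
Unshelve. all: by end_near.
Qed.

Lemma ln_prefix_count_X_asym e : 0 < e -> exists N, forall n, (N <= n)%N ->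
   `| ln_prefix_count R X n - n%:R * (d * wlim ell (ln_prefix_count R Omega)) | <= n%:R * e.
Proof.
move=> e0; have lm0 : 0 <= ln (m%:R : R) by exact/ltW/lnm_gt0.
have h0 : ln_prefix_count R Omega 0 = 0.
  apply/eqP; rewrite eq_le ln_prefix_count_ge0 // andbT.
  by have := ln_prefix_count_le R m_ge2 Omega_neq0 0; rewrite mul0r.
have hk k : 0 <= ln_prefix_count R Omega k <= k%:R * ln m%:R
  by rewrite ln_prefix_count_ge0 // ln_prefix_count_le.
have [N hN] := fibre_average lm0 h0 hk e0.
by exists N => n /hN; rewrite ln_prefix_count_X.
Qed.

End PrefixCount.

Section Box.
Context (R : realType) (m : nat) (m_ge2 : (2 <= m)%N).
Context (A : set (Sigma m)) (A_neq0 : A !=set0).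
Implicit Types (x y : Sigma m).

(** At this scale a set lies in one n-cylinder, and an n-cylinder is an admissible
    set. *)
Lemma covering_numberE n (r : R) : (m%:R ^+ n.+1)^-1 <= r -> r < (m%:R ^+ n)^-1 ->
  covering_number A r = (prefix_count A n)%:R.
Proof.
move=> r1 r2; pose P := [pred u : n.-tuple (letter m) | pref A n (ext u)].
rewrite /covering_number; set S := (X in inf X).
have SN : S (prefix_count A n)%:R.
  exists (prefix_count A n) => //=.
  exists (fun i : 'I_#|P| => [set x | agree n x (ext (enum_val i))]); split.
    move=> x Ax; have Px : trunc n x \in P.
      rewrite unfold_in /=; apply/asboolP; exists x; split => //.
      exact/agree_sym/ext_trunc.
    exists (enum_rank_in Px (trunc n x)) => //=.
    by rewrite enum_rankK_in //; exact/agree_sym/ext_trunc.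
  move=> i; apply: le_trans r1; apply: diam_agree_le => // x y hx hy.
  exact: agree_trans hx (agree_sym hy).
have lb : lbound S (prefix_count A n)%:R.
  move=> _ [N [U [AU dU]] <-]; rewrite ler_nat.
  have /choice[f hf] (u : {u : n.-tuple (letter m) | P u}) :
      exists i : 'I_N, exists z, [/\ A z, agree n z (ext (val u)) & U i z].
    have /asboolP[z [Az zu]] := valP u.
    by have [i _ Ui] := AU z Az; exists i, z.
  have finj : injective f.
    move=> u v e; apply: val_inj; have [z [_ zu Uz]] := hf u; have [w [_ wv Uw]] := hf v.
    rewrite -(trunc_ext (val u)) -(trunc_ext (val v)); apply/trunc_agree.
    apply: agree_trans (agree_sym zu) _; apply: agree_trans wv.
    rewrite e in Uz; apply: (diam_lt_agree m_ge2 _ Uz Uw).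
    exact: le_lt_trans (dU _) r2.
  by have := leq_card f finj; rewrite card_sig card_ord.
apply/eqP; rewrite eq_le; apply/andP; split.
  by apply: ge_inf => //; exists (prefix_count A n)%:R.
by apply: lb_le_inf => //; exists (prefix_count A n)%:R.
Qed.

(** Between the scales m^-(n+1) and m^-n the covering number is constant and - ln r
    varies by ln m only. *)
Lemma box_dimension (D : R) : 0 <= D ->
  (forall e, 0 < e -> exists N, forall n, (N <= n)%N -> `|ln_prefix_count R A n - n%:R * D| <= n%:R * e) ->
  minkowski_ratio A r @[r --> (0:R)^'+] --> (D / ln m%:R)%:E.
Proof.
move=> D0 hD; have lm0 := lnm_gt0 R m_ge2; have m0 := m_gt0 R m_ge2; have m1 := m_gt1 R m_ge2.
apply: cvg_EFin; first exact: nearW.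
apply/cvgrPdist_le => e e0.
pose e' := e * ln m%:R / 2; have e'0 : 0 < e' by rewrite divr_gt0 // mulr_gt0.
have [N1 hN1] := hD _ e'0.
have [N [NN1 NN2 N0]] : exists N, [/\ (N1 <= N)%N, D / e' <= N%:R & (0 < N)%N].
  exists (maxn N1 (Num.bound (D / e'))).+1; split => //; first by rewrite leqW // leq_maxl.
  apply: ltW; apply: (@lt_le_trans _ _ (Num.bound (D / e'))%:R).
    by apply: archi_boundP; rewrite divr_ge0 // ltW.
  by rewrite ler_nat leqW // leq_maxr.
have dl : 0 < (m%:R ^+ N)^-1 :> R by rewrite invr_gt0 exprn_gt0.
near=> r.
have r0 : 0 < r by near: r; exact: nbhs_right_gt.
have rN : r < (m%:R ^+ N)^-1 by near: r; exact: nbhs_right_lt.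
have exn : exists n, (m%:R ^+ n.+1)^-1 <= r.
  have [n hn] := expR_small lm0 r0; exists n; rewrite expm //; apply: hn; exact: leqnSn.
case: (ex_minnP exn) => n hn minn.
have Nn : (N <= n)%N.
  have := le_lt_trans hn rN; rewrite ltf_pV2 ?posrE ?exprn_gt0 // ltr_eXn2l //.
have rn : r < (m%:R ^+ n)^-1.
  case: n hn minn Nn => [|n] hn minn Nn; first by move: Nn; rewrite leqn0 => /eqP e1;
    rewrite e1 in N0.
  by rewrite ltNge; apply/negP => /minn; rewrite ltnn.
rewrite /= (covering_numberE hn rn) -/(ln_prefix_count R A n).
pose t := - ln r; rewrite -/t.
have t1 : n%:R * ln m%:R < t.
  by rewrite /t ltrNr -[ltRHS]expRK -expm // ltr_ln ?posrE // invr_gt0 exprn_gt0.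
have t2 : t <= (n%:R + 1) * ln m%:R.
  rewrite natr1 /t lerNl -[leLHS]expRK -expm // ler_ln ?posrE // invr_gt0 exprn_gt0 //.
have n1 : 1 <= (n%:R : R) by rewrite ler1n; exact: leq_trans N0 Nn.
have t0 : 0 < t by apply: lt_trans t1; rewrite mulr_gt0 //; lra.
have hn1 : (N1 <= n)%N by exact: leq_trans Nn.
have nD : D <= n%:R * e'.
  by rewrite -ler_pdivrMr //; apply: le_trans NN2 _; rewrite ler_nat.
have := hN1 n hn1; rewrite ler_norml => /andP[h1 h2].
have l0 := ln_prefix_count_ge0 R A_neq0 n.
set l := ln_prefix_count R A n in h1 h2 l0 *.
have De : D / ln m%:R * ln m%:R = D by rewrite divfK // gt_eqF.
have ee : e * ln m%:R = e' + e' by rewrite /e'; field.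
rewrite ler_norml; apply/andP; split.
  rewrite lerBrDr addrC -lerBrDr opprK ler_pdivrMr //.
  have : n%:R * ln m%:R * (D / ln m%:R + e) <= t * (D / ln m%:R + e).
    by rewrite ler_wpM2r ?(ltW t1) // addr_ge0 ?divr_ge0 ?(ltW lm0) ?(ltW e0).
  have -> : n%:R * ln m%:R * (D / ln m%:R + e) = n%:R * (D / ln m%:R * ln m%:R)
    + n%:R * (e * ln m%:R) by ring.
  rewrite De ee [t * _]mulrC mulrDr.
  have : 0 <= n%:R * e' by rewrite mulr_ge0 // ltW.
  lra.
rewrite lerBlDr -lerBlDl ler_pdivlMr //.
have [neg|pos] := leP (D / ln m%:R - e) 0.
  by apply: le_trans l0; rewrite mulr_le0_ge0 // ltW.
have : t * (D / ln m%:R - e) <= (n%:R + 1) * ln m%:R * (D / ln m%:R - e).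
  by rewrite ler_wpM2r ?(ltW pos).
have -> : (n%:R + 1) * ln m%:R * (D / ln m%:R - e) = (n%:R + 1) * (D / ln m%:R * ln m%:R)
  - (n%:R + 1) * (e * ln m%:R) by ring.
rewrite De ee [t * _]mulrC mulrDl mulrDr mulrDl mul1r.
have : 0 <= n%:R * e' by rewrite mulr_ge0 // ltW.
lra.
Unshelve. all: by end_near.
Qed.

End Box.

(** * Spherical symmetry *)

Section Branching.
Context (R : realType) (m : nat) (Omega : set (Sigma m)) (Omega_neq0 : Omega !=set0).
Implicit Types (x y : Sigma m).

(** The number of continuations, as a function on sequences. *)
Definition branching k y : R := \sum_(a : letter m) (pref Omega k.+1 (upd y k a))%:R.

Lemma branching_local k : local k (branching k).
Proof.
by move=> x y xy; apply: eq_bigr => a _; rewrite (pref_local _ (agree_updS a xy)).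
Qed.

Lemma branching_ge0 k y : 0 <= branching k y.
Proof. exact: sumr_ge0. Qed.

Lemma branching_gt0 k y : pref Omega k y -> 0 < branching k y.
Proof.
move=> /pref_next[a ha]; rewrite /branching (bigD1 a) //= ha ltr_wpDr //.
exact: sumr_ge0.
Qed.

Lemma branching_continuations k (u : k.-tuple (letter m)) :
  branching k (ext u) = #|continuations Omega u|%:R.
Proof.
rewrite /branching /continuations -sum1_card natr_sum [RHS]big_mkcond /=;
  apply: eq_bigr => a _.
rewrite inE -ext_rcons; case: asboolP => h; first by move/PrefP: h => ->.
by case: (boolP (pref _ _ _)) => // /PrefP.
Qed.

Lemma spherically_symmetricP : spherically_symmetric Omega <->
  forall k, (0 < k)%N -> forall x y, pref Omega k x -> pref Omega k y ->
    branching k x = branching k y.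
Proof.
split=> h k k0.
  move=> x y px py.
  rewrite -(branching_local (@ext_trunc m k x)) -(branching_local (@ext_trunc m k y))
    !branching_continuations.
  congr (_%:R); apply: h => //; apply/PrefP.
    by rewrite (pref_local _ (@ext_trunc m k x)).
  by rewrite (pref_local _ (@ext_trunc m k y)).
move=> u v /PrefP pu /PrefP pv; apply/eqP; rewrite -(eqr_nat R) -!branching_continuations.
by apply/eqP/h.
Qed.

Lemma prefix_countS k : (prefix_count Omega k.+1)%:R = wsum k
  (fun y => (pref Omega k y)%:R * branching k y).
Proof.
rewrite prefix_countE wsumS; apply: eq_wsum => y; rewrite -/(branching k y).
case: (boolP (pref Omega k y)) => np; first by rewrite mul1r.
rewrite mul0r /branching big1 // => a _;
  case: (boolP (pref _ k.+1 _)) => // /(pref_le (leqnSn k)).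
by rewrite (pref_local _ (agree_upd y a)) (negPf np).
Qed.

(** Gibbs' inequality on level k+1 against the mass spread evenly over the
    continuations gives H_(k+1) <= H_k + E[ln c]. Gibbs' inequality on level k
    against sqrt(c) gives H_k + E[ln c] / 2 <= ln (sum of the sqrt(c)). *)
Lemma two_level_entropy (f : nat -> Sigma m -> R) k : consistent f ->
  (forall k y, f k y != 0 -> pref Omega k y) ->
  level_entropy f k + level_entropy f k.+1 <=
    2 * ln (wsum k (fun y => (pref Omega k y)%:R * Num.sqrt (branching k y))).
Proof.
move=> cf fp; have [lf f0 _ _] := cf.
have fpos j y : f j y != 0 -> 0 < f j y by move=> ne; rewrite lt_neqAle eq_sym ne f0.
pose E := wsum k (fun y => f k y * ln (branching k y)).
have h1 : level_entropy f k.+1 <= level_entropy f k + E.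
  pose g y := (pref Omega k.+1 y)%:R * (f k y / branching k y).
  have gpos w : f k.+1 w != 0 -> 0 < g w.
    move=> ne; have tilt := fp _ _ ne.
    have fk : 0 < f k w.
      apply: lt_le_trans (consistent_le w cf (leqnSn k)); exact: fpos.
    by rewrite /g tilt mul1r divr_gt0 // branching_gt0 // (pref_le (leqnSn k)).
  have := @gibbs R (k.+1.-tuple (letter m) : finType) xpredT (fun u => f k.+1 (ext u))
    (fun u => g (ext u)) (fun u _ => f0 _ _) (consistent_wsum1 k.+1 cf).
  have g0 y : 0 <= g y by rewrite mulr_ge0 // divr_ge0 // branching_ge0.
  move=> /(_ (fun u _ => g0 _) (fun u _ => gpos _)).
  rewrite -/(wsum k.+1 (fun y => f k.+1 y * ln (f k.+1 y))) -/(level_entropy f k.+1).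
  rewrite -/(wsum k.+1 (fun y => f k.+1 y * ln (g y))) -/(wsum k.+1 g).
  have -> : wsum k.+1 g = 1.
    rewrite wsumS -(consistent_wsum1 k cf); apply: eq_wsum => y.
    rewrite /g; under eq_bigr do rewrite (lf _ _ _ (agree_upd y _))
      (branching_local (agree_upd y _)).
    rewrite -mulr_suml -/(branching k y) mulrC.
    have [->|ne] := eqVneq (f k y) 0; first by rewrite !mul0r.
    by rewrite divfK // gt_eqF // branching_gt0 // fp.
  rewrite ln1 (@eq_wsum _ _ k.+1 _ (fun y => f k.+1 y * (ln (f k y) - ln (branching k y)))); last first.
    move=> y; have [->|ne] := eqVneq (f k.+1 y) 0; first by rewrite !mul0r.
    have := gpos _ ne; have tilt := fp _ _ ne; rewrite /g tilt mul1r => _.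
    have fk : 0 < f k y.
      apply: lt_le_trans (consistent_le y cf (leqnSn k)); exact: fpos.
    have nk : 0 < branching k y by rewrite branching_gt0 // (pref_le (leqnSn k)).
    by rewrite lnM ?posrE ?invr_gt0 // lnV ?posrE.
  rewrite (consistent_wsum cf (h := fun y => ln (f k y) - ln (branching k y)) _ (leqnSn k)); last first.
    by move=> x y xy; rewrite (lf _ _ _ xy) (branching_local xy).
  rewrite (@eq_wsum _ _ k _ (fun y => f k y * ln (f k y) + - (f k y * ln (branching k y)))); last first.
    by move=> y; rewrite mulrBr.
  rewrite wsumD wsumN -/E.
  have -> : wsum k (fun y => f k y * ln (f k y)) = - level_entropy f k
    by rewrite /level_entropy opprK.
  lra.
have h2 : level_entropy f k + E / 2 <=
  ln (wsum k (fun y => (pref Omega k y)%:R * Num.sqrt (branching k y))).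
  pose g y := (pref Omega k y)%:R * Num.sqrt (branching k y).
  have gpos w : f k w != 0 -> 0 < g w.
    by move=> ne; rewrite /g fp // mul1r sqrtr_gt0 branching_gt0 // fp.
  have := @gibbs R (k.-tuple (letter m) : finType) xpredT (fun u => f k (ext u))
    (fun u => g (ext u)) (fun u _ => f0 _ _) (consistent_wsum1 k cf).
  have g0 y : 0 <= g y by rewrite mulr_ge0 // sqrtr_ge0.
  move=> /(_ (fun u _ => g0 _) (fun u _ => gpos _)).
  rewrite -/(wsum k (fun y => f k y * ln (f k y))) -/(level_entropy f k).
  rewrite -/(wsum k (fun y => f k y * ln (g y))) -/(wsum k g).
  rewrite (@eq_wsum _ _ k (fun y => f k y * ln (g y)) (fun y => f k y * ln (branching k y) * (1 / 2))); last first.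
    move=> y; have [->|ne] := eqVneq (f k y) 0; first by rewrite !mul0r.
    have nk : 0 < branching k y by rewrite branching_gt0 // fp.
    have gE : g y = Num.sqrt (branching k y) by rewrite /g fp // mul1r.
    rewrite -mulrA gE; congr (_ * _).
    have -> : ln (branching k y) = 2 * ln (Num.sqrt (branching k y)).
      by rewrite -[in LHS](sqr_sqrtr (ltW nk)) lnXn ?sqrtr_gt0 // mulr_natl.
    by field.
  by rewrite wsumZr -/E div1r.
lra.
Qed.

(** Strict Cauchy-Schwarz inequality: the number of prefixes of length k+1 is the
    sum of the c over those of length k. *)
Lemma sum_sqrt_lt k : ~ (forall x y, pref Omega k x -> pref Omega k y -> branching k x = branching k y) ->
  2 * ln (wsum k (fun y => (pref Omega k y)%:R * Num.sqrt (branching k y)))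
    < ln_prefix_count R Omega k + ln_prefix_count R Omega k.+1.
Proof.
move=> ns.
set P := fun u : k.-tuple (letter m) => pref Omega k (ext u).
pose s (u : k.-tuple (letter m)) := Num.sqrt (branching k (ext u)).
pose S := \sum_(u | P u) s u; pose Q := \sum_(u | P u) s u ^+ 2.
pose N : R := (prefix_count Omega k)%:R.
have N0 : 0 < N by rewrite ltr0n prefix_count_gt0.
have NE : N = \sum_(u | P u) 1 by rewrite /N /prefix_count -sum1_card natr_sum; apply: eq_bigl.
have mk (F : Sigma m -> R) : wsum k (fun y => (pref Omega k y)%:R * F y) = \sum_(u | P u) F (ext u).
  rewrite /wsum [RHS]big_mkcond /=; apply: eq_bigr => u _; rewrite /P.
  by case: (pref _ _ _); rewrite ?mul1r ?mul0r.
have SE : wsum k (fun y => (pref Omega k y)%:R * Num.sqrt (branching k y)) = S by rewrite mk.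
have QE : (prefix_count Omega k.+1)%:R = Q.
  by rewrite prefix_countS mk; apply: eq_bigr => u _; rewrite sqr_sqrtr // branching_ge0.
have s0 u : P u -> 0 < s u by move=> Pu; rewrite sqrtr_gt0 branching_gt0.
have Q0 : 0 < Q by rewrite -QE ltr0n prefix_count_gt0.
have S0 : 0 < S.
  rewrite lt_neqAle eq_sym sumr_ge0 ?andbT; last by move=> u /s0/ltW.
  apply/eqP => e; have : Q = 0; last by move: Q0 => + e2; rewrite e2 ltxx.
  rewrite /Q big1 // => u Pu; move/eqP: e; rewrite psumr_eq0; last by move=> v /s0/ltW.
  by move=> /allP /(_ u (mem_index_enum u)); rewrite Pu /= => /eqP ->; rewrite expr0n.
(* N (N Q - S^2) is the sum of the squares of the N s_u - S *)
have key : S ^+ 2 < N * Q.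
  rewrite -(ltr_pM2l N0) -subr_gt0.
  have -> : N * (N * Q) - N * S ^+ 2 = \sum_(u | P u) (N * s u - S) ^+ 2.
    transitivity (\sum_(u | P u) (N ^+ 2 * s u ^+ 2 - 2 * N * S * s u + S ^+ 2 * 1)).
      rewrite big_split sumrB /= -!mulr_sumr -NE -/S -/Q; ring.
    by apply: eq_bigr => u _; ring.
  rewrite lt_neqAle eq_sym sumr_ge0 ?andbT; last by move=> u _; exact: sqr_ge0.
  apply/negP; rewrite psumr_eq0; last by move=> u _; exact: sqr_ge0.
  move=> /allP h; apply: ns => x y px py.
  have e z : pref Omega k z -> N * Num.sqrt (branching k z) = S.
    move=> pz; have := h (trunc k z) (mem_index_enum _).
    rewrite /P (pref_local _ (@ext_trunc m k z)) pz /= sqrf_eq0 subr_eq0 => /eqP.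
    by rewrite /s (branching_local (@ext_trunc m k z)).
  have := e _ px; rewrite -(e _ py) => /(mulfI (lt0r_neq0 N0)) es.
  by rewrite -(sqr_sqrtr (branching_ge0 k x)) -(sqr_sqrtr (branching_ge0 k y)) es.
rewrite SE /ln_prefix_count QE -/N -lnM ?posrE // mulr_natl -lnXn //.
by rewrite ltr_ln ?posrE ?exprn_gt0 // mulr_gt0.
Qed.

Definition unif k y : R := (pref Omega k y)%:R / (prefix_count Omega k)%:R.

(** With c continuations for each prefix there are c times as many prefixes on the
    next level. At the root there is only one prefix, hence no condition. *)
Lemma unif_consistent : spherically_symmetric Omega -> consistent unif.
Proof.
move=> /spherically_symmetricP ss.
have N0 k : (0 : R) < (prefix_count Omega k)%:R by rewrite ltr0n prefix_count_gt0.
have N1 : (prefix_count Omega 0)%:R = 1 :> R by rewrite prefix_countE wsum0 pref0.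
split.
- by move=> k x y xy; rewrite /unif (pref_local _ xy).
- by move=> k y; rewrite divr_ge0.
- by move=> y; rewrite /unif pref0 // N1 divr1.
move=> k y; rewrite /unif -mulr_suml -/(branching k y).
case: (boolP (pref Omega k y)) => py; last first.
  rewrite /branching big1 ?mul0r // => a _;
    case: (boolP (pref _ k.+1 _)) => // /(pref_le (leqnSn k)).
  by rewrite (pref_local _ (agree_upd y a)) (negPf py).
have : (prefix_count Omega k.+1)%:R = (prefix_count Omega k)%:R * branching k y.
  rewrite prefix_countS prefix_countE -wsumZr; apply: eq_wsum => x.
  case: (boolP (pref Omega k x)) => px; last by rewrite !mul0r.
  rewrite !mul1r; case: k px py => [|k] px py; last exact: ss.
  exact: branching_local.
have b0 := branching_gt0 py.
by move=> ->; rewrite invfM mulrCA divff ?gt_eqF // mulr1 mul1r.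
Qed.

Lemma level_entropy_unif k : level_entropy unif k = ln_prefix_count R Omega k.
Proof.
have N0 : (0 : R) < (prefix_count Omega k)%:R by rewrite ltr0n prefix_count_gt0.
rewrite /level_entropy /unif (@eq_wsum _ _ _ _ (fun y => (pref Omega k y)%:R * (- ln_prefix_count R Omega k / (prefix_count Omega k)%:R))).
  by rewrite wsumZr -prefix_countE mulrC divfK ?opprK // gt_eqF.
move=> y; case: (pref Omega k y); last by rewrite !mul0r.
by rewrite !mul1r lnV ?posrE // -/(ln_prefix_count R Omega k) mulrC.
Qed.

End Branching.

(** * Comparison of the three dimensions *)

Section Main.
Context (R : realType) (m J : nat) (p : 'I_J -> nat) (ell : nat -> nat) (Omega : set (Sigma m)).
Context (m_ge2 : (2 <= m)%N) (G : generated p ell).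
Context (Omega_neq0 : Omega !=set0) (Omega_closed : closed Omega).
Local Notation d := (cop_density p R).
Local Notation gam := (gammaS R ell).
Local Notation X := (X_set p ell Omega).
Local Notation lnm := (ln (m%:R : R)).
Local Notation Hmu mu := (level_entropy (cyl_mass Omega mu)).

Definition s_sup : \bar R := ereal_sup [set (s_value ell Omega mu)%:E | mu in
      [set mu : probability (borel m) R | mu Omega = 1%E]].

Lemma s_value_le_dimH (mu : probability (borel m) R) : mu Omega = 1%E ->
  ((s_value ell Omega mu)%:E <= dimH R X)%E.
Proof.
move=> mu1; apply: le_ereal_inf_tmp => _ [s [s0 Hs] <-]; rewrite lee_fin leNgt.
apply/negP => hs.
have lm0 := lnm_gt0 R m_ge2; have d0 := cop_density_gt0 G R.
move: hs; rewrite (s_valueE m_ge2 Omega_closed Omega_neq0 mu1 G).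
rewrite ltr_pdivlMr // mulrC => hs.
have lg := lingrowth_cyl_mass m_ge2 Omega_closed Omega_neq0 mu1.
have {}hs : s * lnm / d < wlim ell (Hmu mu).
  by rewrite ltr_pdivrMr // mulrC [ltRHS]mulrC.
have [K] := wlim_lt_ex G lg hs; rewrite ltr_pdivrMr // [ltRHS]mulrC => hK.
have cf := cyl_mass_consistent Omega_closed mu1.
apply: (hausdorff_neq0_entropy G m_ge2 s0 cf _ hK) Hs.
exact: (cyl_mass_support Omega_closed).
Qed.

Lemma dimH_le_tau0 K (s : R) :
  (d * tau0 ell R Omega K + lnm * (gam - inv_sum ell R K)) / lnm <= s -> (dimH R X <= s%:E)%E.
Proof.
move=> hs; have lm0 := lnm_gt0 R m_ge2; have d0 := cop_density_gt0 G R.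
apply/lee_addgt0Pr => e e0; rewrite -EFinD.
have B0 : 0 <= d * tau0 ell R Omega K + lnm * (gam - inv_sum ell R K).
  rewrite addr_ge0 // mulr_ge0 ?(ltW d0) ?(ltW lm0) ?(tau0_ge0 G) //.
  by rewrite subr_ge0 (inv_sum_le G).
have s0 : 0 <= s by apply: le_trans hs; rewrite divr_ge0 // ltW.
apply: ereal_inf_lbound; exists (s + e) => //=.
have se : 0 < s + e by rewrite ltr_wpDl.
split => //; apply: (hausdorff_eq0_tau0 G m_ge2 Omega_neq0 (K := K)) => //.
rewrite -ltr_pdivrMr //; apply: le_lt_trans hs _; by rewrite ltrDl.
Qed.

(** The measure realizing the optimal weights loses only the boundary term of
    [level_entropy_opt_mass], at most K ln m / ell_K. *)
Lemma tau0_realized K : (0 < K)%N -> exists mu : probability (borel m) R, mu Omega = 1%E /\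
  d * tau0 ell R Omega K / lnm <= s_value ell Omega mu + d * (K%:R / (ell K)%:R).
Proof.
move=> K0; have lm0 := lnm_gt0 R m_ge2; have d0 := cop_density_gt0 G R.
have cq := opt_mass_consistent G R m_ge2 Omega_neq0 K.
have qp y : opt_mass ell R Omega K K y != 0 -> pref Omega K y by exact: opt_mass_pref.
have [mu [mu1 muq]] := realize Omega_closed Omega_neq0 cq qp.
exists mu; split => //.
rewrite (s_valueE m_ge2 Omega_closed Omega_neq0 mu1 G).
have lg := lingrowth_cyl_mass m_ge2 Omega_closed Omega_neq0 mu1.
have h1 := wpart_wlim G K lg.
have h2 : wpart ell (Hmu mu) K = \sum_(1 <= k < K) level_entropy (opt_mass ell R Omega K)
  k * wt R ell k.
  rewrite /wpart !big_nat; apply: eq_bigr => k /andP[_ kK]; congr (_ * _).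
  rewrite /level_entropy; congr (- _); apply: eq_wsum => y; by rewrite muq // ltnW.
have h3 := level_entropy_opt_mass G R m_ge2 Omega_neq0 K0.
have h4 : level_entropy (opt_mass ell R Omega K) K / (ell K)%:R <= K%:R / (ell K)%:R * lnm.
  rewrite mulrAC ler_wpM2r ?invr_ge0 //.
  exact: le_trans (level_entropy_le cq qp) (ln_prefix_count_le R m_ge2 Omega_neq0 K).
rewrite ler_pdivrMr // mulrDl divfK ?gt_eqF // -(mulrA d (_ / _) lnm)
  -mulrDr ler_wpM2l ?(ltW d0) //.
by rewrite -h3 -h2 lerD.
Qed.

Lemma dimH_eq_sup : dimH R X = s_sup.
Proof.
have lm0 := lnm_gt0 R m_ge2; have d0 := cop_density_gt0 G R.
apply/eqP; rewrite eq_le; apply/andP; split; last first.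
  by apply: ge_ereal_sup => _ [mu mu1 <-]; exact: s_value_le_dimH.
apply/lee_addgt0Pr => e e0.
have e2 : 0 < e / 2 by rewrite divr_gt0.
have [K0 hK0] := inv_sum_tail G e2.
have /cvgrPdist_le /(_ _ (divr_gt0 e2 d0)) [K1 _ hK1] := cvg_index_over_ell G (R := R).
pose K := (maxn K0 K1).+1.
have KK0 : (K0 <= K)%N by rewrite /K leqW // leq_maxl.
have KK1 : (K1 <= K)%N by rewrite /K leqW // leq_maxr.
have [mu [mu1 hmu]] := tau0_realized (ltn0Sn (maxn K0 K1)).
apply: (@le_trans _ _ ((s_value ell Omega mu)%:E + e%:E)%E); last first.
  by rewrite leeD2r //; apply: ereal_sup_ubound; exists mu.
rewrite -EFinD; apply: (@dimH_le_tau0 K).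
rewrite mulrDl [lnm * _]mulrC mulfK ?gt_eqF //.
have h1 := hK0 K KK0.
have h2 : d * (K%:R / (ell K)%:R) <= e / 2.
  have := hK1 K KK1; rewrite sub0r normrN => h2; rewrite mulrC -ler_pdivlMr //.
  by apply: le_trans h2; exact: ler_norm.
move: hmu; rewrite -/K => hmu; lra.
Qed.

Definition box_value : R := d * wlim ell (ln_prefix_count R Omega) / lnm.

Let lgN := lingrowth_prefix_count R m_ge2 Omega_neq0.

Lemma ratio_cvg : minkowski_ratio X r @[r --> (0:R)^'+] --> (box_value)%:E.
Proof.
apply: (box_dimension m_ge2 (X_neq0 G Omega_neq0)).
  rewrite mulr_ge0 ?(ltW (cop_density_gt0 G R)) //.
  by apply: le_trans (wpart_wlim G 0 lgN); rewrite /wpart big_geq.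
exact: (ln_prefix_count_X_asym G m_ge2 Omega_neq0).
Qed.

Lemma dimM_eq : dimM R X = box_value%:E.
Proof. by apply: cvg_lim => //; exact: ratio_cvg. Qed.

Lemma s_sup_symmetric : spherically_symmetric Omega -> s_sup = box_value%:E.
Proof.
move=> ss; have lm0 := lnm_gt0 R m_ge2; have d0 := cop_density_gt0 G R.
apply/eqP; rewrite eq_le; apply/andP; split.
  apply: ge_ereal_sup => _ [mu mu1 <-]; rewrite lee_fin.
  rewrite (s_valueE m_ge2 Omega_closed Omega_neq0 mu1 G) ler_pM2r ?invr_gt0 // ler_pM2l //.
  apply: (wlim_le G) => //; first exact: lingrowth_cyl_mass.
  by move=> k _; apply: level_entropy_cyl_mass_le.
have cu := unif_consistent R Omega_neq0 ss.
have up k y : unif R Omega k y != 0 -> pref Omega k y.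
  by rewrite /unif; case: (pref Omega k y) => //; rewrite mul0r eqxx.
have h K : ((d * wpart ell (ln_prefix_count R Omega) K / lnm)%:E <= s_sup)%E.
  have [mu [mu1 muf]] := realize Omega_closed Omega_neq0 cu (up K).
  apply: (@le_trans _ _ (s_value ell Omega mu)%:E); last first.
    by apply: ereal_sup_ubound; exists mu.
  rewrite lee_fin (s_valueE m_ge2 Omega_closed Omega_neq0 mu1 G) ler_pM2r ?invr_gt0 // ler_pM2l //.
  have lg := lingrowth_cyl_mass m_ge2 Omega_closed Omega_neq0 mu1.
  apply: le_trans (wpart_wlim G K lg).
  rewrite /wpart !big_nat le_eqVlt; apply/orP; left; apply/eqP;
    apply: eq_bigr => k /andP[_ kK].
  congr (_ * _); rewrite -(level_entropy_unif R Omega_neq0).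
  rewrite /level_entropy; congr (- _); apply: eq_wsum => y; by rewrite muf // ltnW.
apply/lee_addgt0Pr => e e0; rewrite leNgt; apply/negP => he.
have e' : 0 < e * lnm / d by rewrite divr_gt0 // mulr_gt0.
have [K hK] : exists K, wlim ell (ln_prefix_count R Omega) - e * lnm / d <
  wpart ell (ln_prefix_count R Omega) K.
  by apply: (wlim_lt_ex G lgN); rewrite ltrBlDr ltrDl.
have := le_lt_trans (leeD2r e%:E (h K)) he.
rewrite -EFinD lte_fin /box_value; apply/negP; rewrite -leNgt -lerBlDr ltW //.
rewrite -(ltr_pM2r lm0) mulrBl !divfK ?gt_eqF // -(ltr_pM2l (_ : 0 < d^-1)) ?invr_gt0 //.
by rewrite mulrBr !mulKf ?gt_eqF // mulrC.
Qed.

(** Uneven branching at level k costs a fixed amount in one of the two terms k and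
    k+1 of the weighted sum, whatever the measure. *)
Lemma s_sup_not_symmetric : ~ spherically_symmetric Omega -> s_sup <> box_value%:E.
Proof.
move=> ns; have lm0 := lnm_gt0 R m_ge2; have d0 := cop_density_gt0 G R.
have [k [k0 nk]] : exists k, (0 < k)%N /\
   ~ (forall x y, pref Omega k x -> pref Omega k y -> branching R Omega k x = branching R Omega k y).
  apply: contrapT => nex; apply: ns; apply/(spherically_symmetricP R) => k k0.
  by apply: contrapT => h; apply: nex; exists k.
have := sum_sqrt_lt Omega_neq0 nk; set S2 := 2 * _ => hS.
pose delta := ln_prefix_count R Omega k + ln_prefix_count R Omega k.+1 - S2.
have delta0 : 0 < delta by rewrite subr_gt0.
(* the smaller of the two weights bounds the loss from below *)
pose w := Num.min (wt R ell k) (wt R ell k.+1).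
have w0 : 0 < w by rewrite lt_min !(wt_gt0 G).
pose eta := d * (w * delta) / lnm.
have eta0 : 0 < eta by rewrite divr_gt0 // mulr_gt0 // mulr_gt0.
have hmu (mu : probability (borel m) R) : mu Omega = 1%E ->
    s_value ell Omega mu <= box_value - eta.
  move=> mu1; rewrite (s_valueE m_ge2 Omega_closed Omega_neq0 mu1 G).
  rewrite /box_value /eta -mulrBl -mulrBr ler_pM2r ?invr_gt0 // ler_pM2l // lerBrDr.
  have lg := lingrowth_cyl_mass m_ge2 Omega_closed Omega_neq0 mu1.
  have hle j := level_entropy_cyl_mass_le Omega_closed mu1 j.
  have h2 : Hmu mu k + Hmu mu k.+1 <= S2.
    apply: two_level_entropy; first exact: cyl_mass_consistent.
    by move=> j y; exact: cyl_mass_pref.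
  have hn n : (k.+2 <= n)%N ->
    wpart ell (Hmu mu) n + w * delta <= wpart ell (ln_prefix_count R Omega) n.
    move=> kn; rewrite -lerBrDl /wpart -sumrB.
    under eq_bigr do rewrite -mulrBl.
    rewrite (big_cat_nat (n := k)) //=; last by lia.
    rewrite (big_cat_nat (n := k.+2) (m := k)) //=; last by lia.
    have -> : \sum_(k <= i < k.+2) (ln_prefix_count R Omega i - Hmu mu i) * wt R ell i =
       (ln_prefix_count R Omega k - Hmu mu k) * wt R ell k +
         (ln_prefix_count R Omega k.+1 - Hmu mu k.+1) * wt R ell k.+1.
      by rewrite big_nat_recr //= big_nat1.
    have p1 a b : (0 < a)%N ->
      0 <= \sum_(a <= i < b) (ln_prefix_count R Omega i - Hmu mu i) * wt R ell i.
      move=> a0; rewrite big_nat; apply: sumr_ge0 => i /andP[ai _].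
      apply: mulr_ge0; first by rewrite subr_ge0.
      by apply/ltW/(wt_gt0 G)/(leq_trans a0).
    have q1 := p1 1%N k isT; have q2 := p1 k.+2 n isT.
    have q3 : w * (ln_prefix_count R Omega k - Hmu mu k)
      <= (ln_prefix_count R Omega k - Hmu mu k) * wt R ell k.
      by rewrite mulrC ler_wpM2l ?subr_ge0 // ge_min lexx.
    have q4 : w * (ln_prefix_count R Omega k.+1 - Hmu mu k.+1)
      <= (ln_prefix_count R Omega k.+1 - Hmu mu k.+1) * wt R ell k.+1.
      by rewrite mulrC ler_wpM2l ?subr_ge0 // ge_min lexx orbT.
    have q5 : w * delta <= w * (ln_prefix_count R Omega k - Hmu mu k)
      + w * (ln_prefix_count R Omega k.+1 - Hmu mu k.+1).
      by rewrite -mulrDr ler_wpM2l ?(ltW w0) // /delta; lra.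
    apply: (le_trans q5); lra.
  have c1 : (fun n => wpart ell (Hmu mu) n + w * delta) @ \oo --> wlim ell (Hmu mu) + w * delta.
    by apply: cvgD; [exact: (wlim_cvg G lg)|exact: cvg_cst].
  rewrite -(cvg_lim _ c1) //; apply: ler_lim.
  - by apply: cvgP c1.
  - exact: (wpart_cvg G lgN).
  - by exists k.+2.
move=> e; have : (s_sup <= (box_value - eta)%:E)%E.
  by apply: ge_ereal_sup => _ [mu mu1 <-]; rewrite lee_fin hmu.
by rewrite e lee_fin leNgt ltrBlDr ltrDl eta0.
Qed.

End Main.

Theorem theorem2p2 (R : realType) (m J : nat) (p : 'I_J -> nat)
    (ell : nat -> nat) (Omega : set (Sigma m))
    (m_ge2 : (2 <= m)%N) (J_ge2 : (2 <= J)%N)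
    (p_prime : forall j, prime (p j)) (p_inj : injective p)
    (ellP : increasing_enumeration ell (semigroup p))
    (Omega_neq0 : Omega !=set0) (Omega_closed : closed Omega) :
  dimH R (X_set p ell Omega) =
    ereal_sup [set (s_value ell Omega mu)%:E | mu in
      [set mu : probability (borel m) R | mu Omega = 1%E]]
  /\
  has_dimM R (X_set p ell Omega) /\
  (dimH R (X_set p ell Omega) = dimM R (X_set p ell Omega) <->
   spherically_symmetric Omega).
Proof.
have G : generated p ell by split => //; exact: ltnW.
have eH := dimH_eq_sup R m_ge2 G Omega_neq0 Omega_closed.
have cM := ratio_cvg (R := R) m_ge2 G Omega_neq0.
split=> //; split; first exact: (cvgP _ cM).
rewrite eH (dimM_eq R m_ge2 G Omega_neq0); split => [e|]; last exact: s_sup_symmetric.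
apply: contrapT => ns; exact: s_sup_not_symmetric ns e.
Qed.
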